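(* Let $g_1(\tau),g_2(\tau),g_3(\tau)$ be functions satisfying $$2\pi i\,g_1'(\tau)=\tfrac1{12}g_2(\tau)-g_1(\tau)^2,\qquad 2\pi i\,g_2'(\tau)=6g_3(\tau)-4g_1(\tau)g_2(\tau),\qquad 2\pi i\,g_3'(\tau)=\tfrac13g_2(\tau)^2-6g_1(\tau)g_3(\tau).$$ Writing $g_j=g_j(\tau(x))$, $z_a=z_a(x)$, $z_a'=z_a'(x)$, $\tau'=\tau'(x)$ on the right-hand sides, the formulas $$\{\tau(x),\tau(y)\}=0,\qquad \{\tau(x),z_a(y)\}=2\pi i\,z_a(y)\,\delta'(x-y),\quad a=1,2,$$ $$\{z_1(x),z_1(y)\}=\Big(-\tfrac16g_2z_1z_2+\tfrac12g_3z_2^2\Big)\delta'(x-y)+\Big(-\tfrac1{12}g_2z_2z_1'+\big(\tfrac12g_3z_2-\tfrac1{12}g_2z_1\big)z_2'+\big((6g_3-4g_1g_2)z_1z_2+(18g_1g_3-g_2^2)z_2^2\big)\tfrac{i\tau'}{24\pi}\Big)\delta(x-y),$$ $$\{z_1(x),z_2(y)\}=\Big(2g_1z_1z_2-\tfrac13g_2z_2^2\Big)\delta'(x-y)+\Big(g_1z_2z_1'+\big(g_1z_1-\tfrac13g_2z_2\big)z_2'-(2g_1g_2-3g_3)z_2^2\,\tfrac{i\tau'}{12\pi}\Big)\delta(x-y),$$ $$\{z_2(x),z_2(y)\}=\Big(-2z_1z_2+4g_1z_2^2\Big)\delta'(x-y)+\Big(-z_2z_1'+(4g_1z_2-z_1)z_2'+(12g_1^2-g_2)z_2^2\,\tfrac{i\tau'}{12\pi}\Big)\delta(x-y)$$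 define a Poisson structure on the set of variables $\tau(x),z_1(x),z_2(x)$. Moreover, $p(x)=\frac{z_1(x)}{z_2(x)}$ satisfies, after the (then central) field $\tau(x)$ is replaced by a constant parameter $\tau$ in the formula for $\{p(x),p(y)\}$, $$\{p(x),p(y)\}=G(p(x))\,\delta'(x-y)+\tfrac12G'(p(x))\,p'(x)\,\delta(x-y),\qquad G(p)=-\tfrac12\big(4p^3-g_2(\tau)p-g_3(\tau)\big).$$
   Context: Here $x,y$ are loop (space) variables, $\delta$ is the delta function, $\delta'$ its derivative; primes on fields denote $x$-derivatives, $g_j'(\tau)$ is the derivative in $\tau$, and $G'$ is the derivative of $G$ in $p$. The field $\tau(x)$ takes values in the upper half-plane $\mathrm{Im}\,\tau>0$. In the paper $g_1,g_2,g_3$ are the following functions, which satisfy the differential equations $2\pi i\,g_1'(\tau)=\tfrac1{12}g_2(\tau)-g_1(\tau)^2$, $2\pi i\,g_2'(\tau)=6g_3(\tau)-4g_1(\tau)g_2(\tau)$, $2\pi i\,g_3'(\tau)=\tfrac13g_2(\tau)^2-6g_1(\tau)g_3(\tau)$ (with $\mathbf{q}=e^{2\pi i\tau}$): $$g_1=\tfrac{\pi^2}{3}-8\pi^2\sum_{m\ge1}\tfrac{m\mathbf{q}^m}{1-\mathbf{q}^m},\quad g_2=\tfrac43\pi^4+320\pi^4\sum_{m\ge1}\tfrac{m^3\mathbf{q}^m}{1-\mathbf{q}^m},\quad g_3=\tfrac8{27}\pi^6-\tfrac{448}{3}\pi^6\sum_{m\ge1}\tfrac{m^5\mathbf{q}^m}{1-\mathbf{q}^m}.$$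 Brackets of fields are extended to functions of the fields and their derivatives in the usual way for Poisson structures of hydrodynamic type: by bilinearity, the Leibniz rule, and compatibility with differentiation in $x$ and $y$; brackets not listed (such as $\{z_2(x),z_1(y)\}$) are determined by anticommutativity. $\{A(x),B(y)\}$ is understood as a distribution in $x,y$ supported on $x=y$. ''Poisson structure'' means that anticommutativity $\{A(x),B(y)\}=-\{B(y),A(x)\}$ and the Jacobi identity hold. By the brackets $\{\tau(x),z_a(y)\}=2\pi i\,z_a(y)\,\delta'(x-y)$, $a=1,2$, one has $\{\tau(x),p(y)\}=0$, so $\tau(x)$ is central in the Poisson algebra generated by $\tau(x),p(x)$ and can be set to a constant parameter (so that $\tau'(x)$ is replaced by $0$). *)

(* Defs.v *)
From HB Require Import structures.
From mathcomp Require Import all_boot all_order all_algebra.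
From mathcomp Require Import complex.
From mathcomp Require Import all_classical all_reals all_analysis.

Set Implicit Arguments.
Unset Strict Implicit.
Unset Printing Implicit Defensive.

Import Order.TTheory GRing.Theory Num.Theory.
Import numFieldNormedType.Exports.

Local Open Scope classical_set_scope.
Local Open Scope ring_scope.

(* Typing R[i] as a numClosedFieldType makes the generic topology and normed
   module structure of a numeric field available on it. *)
Definition cplx (R : realType) : numClosedFieldType := R[i].

(* Formal calculus of local functionals of the fields u_i(x), i : I, with
   values in C.

   A point u of [jet] is the list of values u_i^{(n)}(x) at one point x of all
   fields and all their x-derivatives: u (i, n) stands for u_i^{(n)}(x).  It
   carries the product topology.  A function of the fields and their
   derivatives is an F : jet -> C, and F(x) means F evaluated at the jet of the
   fields at x.  All these operators are total; they are meaningful at the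
   points of an open set D of jets on which F is regular in the sense below,
   and only their values on D are ever compared. *)
Section LocalFunctions.
Variables (I : finType) (C : numClosedFieldType).

Definition jet := {ptws (I * nat)%type -> C}.

Implicit Types (D : set jet) (F : jet -> C) (u v : jet) (a : I * nat).

Definition fld (i : I) (n : nat) : jet -> C := fun u => u (i, n).

Definition set_jet u a (w : C) : jet := fun b => if b == a then w else u b.

(* complex partial derivative with respect to u_i^{(n)}, a = (i, n) *)
Definition pder a F : jet -> C :=
  fun u => derive1 (fun w : C => F (set_jet u a w)) (u a).

Definition pders (s : seq (I * nat)) F : jet -> C := foldr pder F s.

Definition finite_order F := exists N : nat,
  forall u v, (forall a, (a.2 < N)%N -> u a = v a) -> F u = F v.

(* F involves finitely many derivatives of the fields, and on D all its
   iterated complex partial derivatives exist and are continuous, i.e. F is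
   holomorphic on D in the finitely many variables it depends on. *)
Definition regular D F := finite_order F /\
  forall (s : seq (I * nat)) u, D u ->
    {for u, continuous (pders s F)} /\
    forall a, derivable (fun w : C => pders s F (set_jet u a w)) (u a) 1.

(* total x-derivative: sum over (i, n) of u_i^{(n+1)} dF/du_i^{(n)} *)
Definition Dtot F : jet -> C :=
  fun u => \sum_(a \in [set: I * nat]) u (a.1, a.2.+1) * pder a F u.

End LocalFunctions.

(* Distributions supported on the diagonal, in normal form.  For a space V of
   coefficients at x with x-derivative d,
     E : {poly V}   stands for   \sum_k E`_k(x) delta^{(k)}(x - y). *)
Section DiagonalDistributions.
Variables (V : nzRingType) (d : V -> V).

Definition delta (k : nat) : {poly V} := 'X^k.

(* normal form of f(y) delta^{(k)}(x - y) = d_x^k (f(x) delta(x - y)) *)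
Definition ydelta (f : V) (k : nat) : {poly V} :=
  \sum_(j < k.+1) (iter (k - j) d f *+ 'C(k, j)) *: delta j.

(* d/dx and d/dy of E(x, y) *)
Definition dx (E : {poly V}) : {poly V} := map_poly d E + E * 'X.
Definition dy (E : {poly V}) : {poly V} := - (E * 'X).

(* f(y) E(x, y), V being commutative in all uses *)
Definition aty (f : V) (E : {poly V}) : {poly V} :=
  \sum_(k < size E) E`_k *: ydelta f k.

(* E(y, x), using delta^{(k)}(y - x) = (-1)^k delta^{(k)}(x - y) *)
Definition flip (E : {poly V}) : {poly V} :=
  \sum_(k < size E) (-1) ^+ k *: ydelta E`_k k.

End DiagonalDistributions.
Arguments delta {V} k.

Section Brackets.
Variables (I : finType) (C : numClosedFieldType).

Local Notation jet := (jet I C).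
Local Notation fct := (jet -> C).

Definition dist2 := {poly fct}.

(* E : dist3 stands for
     \sum_(k, l) E`_k`_l(x) delta^{(k)}(x - y) delta^{(l)}(x - z). *)
Definition dist3 := {poly {poly fct}}.

Definition eq2 (D : set jet) (E E' : dist2) :=
  forall (k : nat) u, D u -> E`_k u = E'`_k u.
Definition eq3 (D : set jet) (E E' : dist3) :=
  forall (k l : nat) u, D u -> E`_k`_l u = E'`_k`_l u.

Definition dist_dx : dist2 -> dist2 := dx (@Dtot I C).
Definition dist_dy : dist2 -> dist2 := @dy fct.
Definition dist_aty : fct -> dist2 -> dist2 := aty (@Dtot I C).
Definition dist_flip : dist2 -> dist2 := flip (@Dtot I C).

(* E(y, z, x).  With F_l(x, z) := \sum_k E`_k`_l(x) delta^{(k)}(x - z),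
     E(y, z, x) = \sum_l F_l(y, z) delta^{(l)}(y - x). *)
Definition cyc (E : dist3) : dist3 := flip dist_dx (swapXY E).

(* {A(x), B(y)} for the bracket with {u_i(x), u_j(y)} = P i j, namely
     \sum_(i, m, j, n) dA/du_i^{(m)}(x) dB/du_j^{(n)}(y)
                       d_x^m d_y^n {u_i(x), u_j(y)}. *)
Definition bracket (P : I -> I -> dist2) (A B : fct) : dist2 :=
  \sum_(a \in [set: I * nat]) \sum_(b \in [set: I * nat])
    pder a A *: dist_aty (pder b B)
      (iter a.2 dist_dx (iter b.2 dist_dy (P a.1 b.1))).

(* {{A(x), B(y)}, E(z)} *)
Definition bracket3 (P : I -> I -> dist2) (A B E : fct) : dist3 :=
  map_poly (fun c : fct => bracket P c E) (bracket P A B).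

(* {u_i(x), u_j(y)} = P i j, extended to all regular functions on D, is a
   Poisson structure.  The fields before ps_anticomm record that [bracket P] is
   the extension of P by bilinearity, the Leibniz rule and compatibility with
   d/dx and d/dy. *)
Record poisson_structure (D : set jet) (P : I -> I -> dist2) : Prop := {
  ps_regular : forall A B, regular D A -> regular D B ->
    forall k : nat, regular D (bracket P A B)`_k;
  ps_fields : forall i j, eq2 D (bracket P (fld i 0) (fld j 0)) (P i j);
  ps_addl : forall A B E, regular D A -> regular D B -> regular D E ->
    eq2 D (bracket P (A + B) E) (bracket P A E + bracket P B E);
  ps_addr : forall A B E, regular D A -> regular D B -> regular D E ->
    eq2 D (bracket P E (A + B)) (bracket P E A + bracket P E B);
  ps_scalel : forall (c : C) A B, regular D A -> regular D B ->
    eq2 D (bracket P (cst c * A) B) ((cst c : fct) *: bracket P A B);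
  ps_scaler : forall (c : C) A B, regular D A -> regular D B ->
    eq2 D (bracket P A (cst c * B)) ((cst c : fct) *: bracket P A B);
  ps_leibnizl : forall A B E, regular D A -> regular D B -> regular D E ->
    eq2 D (bracket P (A * B) E) (A *: bracket P B E + B *: bracket P A E);
  ps_leibnizr : forall A B E, regular D A -> regular D B -> regular D E ->
    eq2 D (bracket P E (A * B))
          (dist_aty A (bracket P E B) + dist_aty B (bracket P E A));
  ps_derl : forall A B, regular D A -> regular D B ->
    eq2 D (bracket P (Dtot A) B) (dist_dx (bracket P A B));
  ps_derr : forall A B, regular D A -> regular D B ->
    eq2 D (bracket P A (Dtot B)) (dist_dy (bracket P A B));
  ps_anticomm : forall A B, regular D A -> regular D B ->
    eq2 D (bracket P A B) (- dist_flip (bracket P B A));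
  ps_jacobi : forall A B E, regular D A -> regular D B -> regular D E ->
    eq3 D (bracket3 P A B E + cyc (bracket3 P B E A)
             + cyc (cyc (bracket3 P E A B))) 0
}.

End Brackets.

Inductive field3 := Tau | Z1 | Z2.

Definition ord_of_field3 (f : field3) : 'I_3 :=
  match f with Tau => inord 0 | Z1 => inord 1 | Z2 => inord 2 end.
Definition field3_of_ord (k : 'I_3) : field3 :=
  match val k with 0%N => Tau | 1%N => Z1 | _ => Z2 end.
Lemma ord_of_field3K : cancel ord_of_field3 field3_of_ord.
Proof. by case; rewrite /field3_of_ord /= inordK. Qed.
HB.instance Definition _ := Finite.copy field3 (can_type ord_of_field3K).

Section TheBracket.
Variables (R : realType) (g1 g2 g3 : cplx R -> cplx R).

Local Notation C := (cplx R).
Local Notation jet := (jet field3 C).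
Local Notation fct := (jet -> C).

Definition piC : C := (pi : R)%:C%C.
Definition twopii : C := 2 * piC * 'i.

Definition upper_half : set jet := [set u | 0 < 'Im (u (Tau, 0%N))].

Definition tau_z (a : field3) : dist2 field3 C :=
  dist_aty (cst twopii * fld a 0) (delta 1).

Definition z1_z1 : dist2 field3 C :=
  (fun u : jet =>
    let t := u (Tau, 0%N) in let z1 := u (Z1, 0%N) in let z2 := u (Z2, 0%N) in
    - (6^-1 * g2 t * z1 * z2) + 2^-1 * g3 t * z2 ^+ 2) *: delta 1
  + (fun u : jet =>
    let t := u (Tau, 0%N) in let t' := u (Tau, 1%N) in
    let z1 := u (Z1, 0%N) in let z1' := u (Z1, 1%N) in
    let z2 := u (Z2, 0%N) in let z2' := u (Z2, 1%N) in
    - (12^-1 * g2 t * z2 * z1')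
    + (2^-1 * g3 t * z2 - 12^-1 * g2 t * z1) * z2'
    + ((6 * g3 t - 4 * g1 t * g2 t) * z1 * z2
       + (18 * g1 t * g3 t - g2 t ^+ 2) * z2 ^+ 2)
      * ('i * t' / (24 * piC))) *: delta 0.

Definition z1_z2 : dist2 field3 C :=
  (fun u : jet =>
    let t := u (Tau, 0%N) in let z1 := u (Z1, 0%N) in let z2 := u (Z2, 0%N) in
    2 * g1 t * z1 * z2 - 3^-1 * g2 t * z2 ^+ 2) *: delta 1
  + (fun u : jet =>
    let t := u (Tau, 0%N) in let t' := u (Tau, 1%N) in
    let z1 := u (Z1, 0%N) in let z1' := u (Z1, 1%N) in
    let z2 := u (Z2, 0%N) in let z2' := u (Z2, 1%N) in
    g1 t * z2 * z1' + (g1 t * z1 - 3^-1 * g2 t * z2) * z2'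
    - (2 * g1 t * g2 t - 3 * g3 t) * z2 ^+ 2
      * ('i * t' / (12 * piC))) *: delta 0.

Definition z2_z2 : dist2 field3 C :=
  (fun u : jet =>
    let t := u (Tau, 0%N) in let z1 := u (Z1, 0%N) in let z2 := u (Z2, 0%N) in
    - (2 * z1 * z2) + 4 * g1 t * z2 ^+ 2) *: delta 1
  + (fun u : jet =>
    let t := u (Tau, 0%N) in let t' := u (Tau, 1%N) in
    let z1 := u (Z1, 0%N) in let z1' := u (Z1, 1%N) in
    let z2 := u (Z2, 0%N) in let z2' := u (Z2, 1%N) in
    - (z2 * z1') + (4 * g1 t * z2 - z1) * z2'
    + (12 * g1 t ^+ 2 - g2 t) * z2 ^+ 2
      * ('i * t' / (12 * piC))) *: delta 0.

Definition basic_bracket (i j : field3) : dist2 field3 C :=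
  match i, j with
  | Tau, Tau => 0
  | Tau, Z1 => tau_z Z1
  | Tau, Z2 => tau_z Z2
  | Z1, Tau => - dist_flip (tau_z Z1)
  | Z2, Tau => - dist_flip (tau_z Z2)
  | Z1, Z1 => z1_z1
  | Z1, Z2 => z1_z2
  | Z2, Z1 => - dist_flip z1_z2
  | Z2, Z2 => z2_z2
  end.

Definition pfun : fct := fun u => u (Z1, 0%N) / u (Z2, 0%N).

Definition Gpoly (t : C) : {poly C} :=
  - (2^-1 *: (4 *: 'X^3 - g2 t *: 'X - (g3 t)%:P)).

End TheBracket.

(* Main.v *)
Require Import Defs.
From HB Require Import structures.
From mathcomp Require Import all_boot all_order all_algebra.
From mathcomp Require Import complex ring lra.
From mathcomp Require Import all_classical all_reals all_analysis.

Set Implicit Arguments.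
Unset Strict Implicit.
Unset Printing Implicit Defensive.

Import Order.TTheory GRing.Theory Num.Theory.
Import numFieldNormedType.Exports.
Local Open Scope classical_set_scope.
Local Open Scope ring_scope.

(** A distribution supported on the diagonal, \sum_k E_k(x) delta^{(k)}(x - y),
    is a differential operator in disguise: a polynomial in the symbol of
    d = d/dx, for which the exchange of x and y is the formal adjoint and a
    coefficient f(y) is composition with multiplication by f.  The bracket of
    two functionals A, B of the fields is D_A P D_B^*, where D_A is the
    linearisation of A and P the matrix of brackets of the fields.

    Once functions are identified when they agree on the open set D, the regular
    functions form a commutative ring with commuting partial derivatives and a
    total derivative ([differential_regfun]).  There, the Leibniz rules and the
    compatibility with d/dx and d/dy hold because the bracket is, in each
    argument, the derivation given by the chain rule from its values on the
    fields ([der]), and anticommutativity of the bracket reduces to that of P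
    ([br_anticomm]).  The Jacobi identity reduces to triples of fields as well:
    second derivatives of A occur in {{A, B}, E} and {{A, E}, B} only, are
    symmetric there and cancel, so that the sum of the three double brackets is
    a derivation in A ([jacobiator_der]), and by rotation in B and E
    ([jacobiator_from_fields]).  Symmetry of the second derivatives is a
    statement of analysis about functions with continuous complex partial
    derivatives; it comes from the real mean value theorem ([pderC]).

    For fields u_i with {u_i(x), u_j(y)} = g_ij delta' + h_ij delta, the Jacobi
    identity is the vanishing of six coefficients for each triple
    ([jacobiator_hydro]).  For the given bracket these are polynomials in the
    fields, their derivatives, g1, g2, g3 and 2 pi i; the differential equations
    express the derivatives of g1, g2, g3 in the same terms, and the
    coefficients vanish identically ([gen_jacobi]).

    For the ratio p = z1 / z2, the quotient rule gives {tau, p} = 0, as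
    {tau, z1} and {tau, z2} are proportional to z1 and z2 with the same factor,
    and it gives the coefficient of delta' in {p, p}, in which g1 cancels
    ([br_ratio]).  By anticommutativity the coefficient of delta is half the
    total derivative of the coefficient of delta'; for tau' = 0 this is
    G'(p) p' / 2.

    All identities proved in the ring of regular functions are carried to the
    functions themselves by [represents] ([poisson_transfer]). *)

(** * Distributions supported on the diagonal *)

Section Additive.
Variables (V W : nzRingType) (f : {additive V -> W}).

Lemma coef_map_additive (E : {poly V}) k : (map_poly f E)`_k = f E`_k.
Proof. by rewrite coef_map_id0 ?raddf0. Qed.

Lemma map_additive_is_additive : zmod_morphism (map_poly f).
Proof.
by move=> E F; apply/polyP=> k; rewrite !(coefB, coef_map_additive) raddfB.
Qed.

Lemma map_additiveC c : map_poly f c%:P = (f c)%:P.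
Proof.
by apply/polyP=> k; rewrite coef_map_additive !coefC; case: eqP; rewrite ?raddf0.
Qed.

Lemma map_additiveMX E : map_poly f (E * 'X) = map_poly f E * 'X.
Proof.
by apply/polyP=> k; rewrite !(coefMX, coef_map_additive); case: eqP; rewrite ?raddf0.
Qed.
End Additive.

HB.instance Definition _ (V W : nzRingType) (f : {additive V -> W}) :=
  GRing.isZmodMorphism.Build _ _ (map_poly f) (map_additive_is_additive f).

Section DiagonalCalculus.
Variables (V : nzRingType) (d : {additive V -> V}).
Implicit Types (E F : {poly V}) (f c : V).

Lemma dx_is_additive : zmod_morphism (dx d).
Proof. by move=> E F; rewrite /dx raddfB mulrBl opprD addrACA. Qed.
HB.instance Definition _ := GRing.isZmodMorphism.Build _ _ (dx d) dx_is_additive.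

Lemma dyE E : dy E = - (E * 'X).
Proof. by []. Qed.

Lemma coef_dx E k : (dx d E)`_k = d E`_k + (if k is k'.+1 then E`_k' else 0).
Proof. by rewrite /dx coefD coefMX coef_map_additive; case: k. Qed.

Lemma dxC c : dx d c%:P = (d c)%:P + c%:P * 'X.
Proof. by rewrite /dx map_additiveC. Qed.

Lemma dxMX E : dx d (E * 'X) = dx d E * 'X.
Proof. by rewrite /dx map_additiveMX -mulrDl. Qed.

Lemma iter_dxMX n E : iter n (dx d) (E * 'X) = iter n (dx d) E * 'X.
Proof. by elim: n => //= n ->; rewrite dxMX. Qed.

Lemma iter_dxD n E F :
  iter n (dx d) (E + F) = iter n (dx d) E + iter n (dx d) F.
Proof. by elim: n => //= n ->; rewrite raddfD. Qed.

Lemma iter_dxN n E : iter n (dx d) (- E) = - iter n (dx d) E.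
Proof. by elim: n => //= n ->; rewrite raddfN. Qed.

(** The binomial coefficients of the normal form are those of the k-fold
    product rule applied to f(x) delta(x - y); this closed form turns every
    statement on normal forms into one on [dx]. *)
Lemma ydeltaE f k : ydelta d f k = iter k (dx d) f%:P.
Proof.
rewrite /ydelta /delta; elim: k f => [|k IHk] f.
  by rewrite big_ord_recl big_ord0 /= addr0 bin0 mulr1n expr0 alg_polyC.
rewrite iterSr dxC iter_dxD iter_dxMX -!IHk mulr_suml.
rewrite big_ord_recl [X in _ = X + _]big_ord_recl /= !bin0 !subn0 -iterSr.
rewrite -addrA; congr (_ + _).
rewrite big_ord_recr [X in _ = _ + X]big_ord_recr /= /bump /= !add1n subnn !binn /=.
rewrite -scalerAl -exprSr addrA; congr (_ + _); last by rewrite subnn.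
rewrite -big_split; apply: eq_bigr => i _ /=.
rewrite -scalerAl -exprSr -scalerDl; congr (_ *: _).
rewrite /bump !add1n subSS binS mulrnDr -iterSr; congr (_ + _).
by rewrite -subSn ?subSS //; apply: ltn_ord.
Qed.

Lemma flip_widen N E : (size E <= N)%N ->
  flip d E = \sum_(k < N) (-1) ^+ k *: iter k (dx d) (E`_k)%:P.
Proof.
move=> leN; rewrite /flip (big_ord_widen N (fun k => (-1) ^+ k *: ydelta d E`_k k)) //.
rewrite big_mkcond; apply: eq_bigr => k _; rewrite ydeltaE; case: ltnP => // le.
rewrite nth_default //=; suff -> : iter k (dx d) 0 = 0 by rewrite scaler0.
by elim: (k : nat) => //= n ->; rewrite raddf0.
Qed.

Lemma flip_is_additive : zmod_morphism (flip d).
Proof.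
move=> E F; pose N := maxn (size E) (size F).
rewrite !(@flip_widen N) ?leq_maxl ?leq_maxr //; last first.
  by rewrite (leq_trans (size_polyD _ _)) // size_polyN.
rewrite -sumrB; apply: eq_bigr => k _; rewrite -scalerBr coefB polyCB.
by rewrite iter_dxD iter_dxN.
Qed.
HB.instance Definition _ := GRing.isZmodMorphism.Build _ _ (flip d) flip_is_additive.

Lemma flipC c : flip d c%:P = c%:P.
Proof.
rewrite (@flip_widen 1) ?size_polyC_leq1 // big_ord_recl big_ord0 addr0.
by rewrite expr0 scale1r coefC.
Qed.

Lemma dx_sign n E : dx d ((-1) ^+ n *: E) = (-1) ^+ n *: dx d E.
Proof.
by rewrite -signr_odd; case: odd; rewrite ?(scaleN1r, scale1r) // raddfN.
Qed.

(** Multiplication by 'X is - d/dy, which the exchange of x and y turns into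
    - d/dx.  With [flipC], this determines [flip] by induction on polynomials;
    the other rules for [flip] are obtained in this way. *)
Lemma flipMX E : flip d (E * 'X) = - dx d (flip d E).
Proof.
have [->|E0] := eqVneq E 0; first by rewrite mul0r !raddf0 ?oppr0.
rewrite (@flip_widen (size E).+1) ?size_mulX //.
rewrite (@flip_widen (size E) E) // big_ord_recl coefMX eqxx /=.
rewrite scale1r add0r raddf_sum -sumrN; apply: eq_bigr => k _.
by rewrite coefMX /= /bump /= add1n dx_sign exprS -scalerA scaleN1r.
Qed.

Lemma flipD E F : flip d (E + F) = flip d E + flip d F.
Proof. exact: raddfD. Qed.
Lemma flipN E : flip d (- E) = - flip d E.
Proof. exact: raddfN. Qed.
Lemma flip0 : flip d 0 = 0.
Proof. exact: raddf0. Qed.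
Lemma dxD E F : dx d (E + F) = dx d E + dx d F.
Proof. exact: raddfD. Qed.
Lemma dxN E : dx d (- E) = - dx d E.
Proof. exact: raddfN. Qed.

Lemma flip_dy E : flip d (dy E) = dx d (flip d E).
Proof. by rewrite /dy flipN flipMX opprK. Qed.

Lemma flip_dx E : flip d (dx d E) = dy (flip d E).
Proof.
elim/poly_ind: E => [|E c IHE]; first by rewrite !raddf0 /dy mul0r oppr0.
rewrite dxD dxMX dxC 3!flipD !flipMX IHE !flipC dxC.
rewrite /dy dxN dxMX (mulrDl (- _)) mulNr !opprD !opprK; congr (_ + _).
by rewrite addrA subrr add0r.
Qed.

(** As differential operators, E(y, x) is the formal adjoint of E(x, y). *)
Lemma flipK E : flip d (flip d E) = E.
Proof.
elim/poly_ind: E => [|E c IHE]; first by rewrite !raddf0.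
by rewrite !flipD flipMX flipN flip_dx IHE /dy opprK !flipC.
Qed.

Lemma aty_widen N f E : (size E <= N)%N ->
  aty d f E = \sum_(k < N) E`_k *: iter k (dx d) f%:P.
Proof.
move=> leN; rewrite /aty (big_ord_widen N (fun k => E`_k *: ydelta d f k)) //.
rewrite big_mkcond; apply: eq_bigr => k _; rewrite ydeltaE; case: ltnP => // le.
by rewrite nth_default // scale0r.
Qed.

Lemma aty_is_additive f : zmod_morphism (aty d f).
Proof.
move=> E F; pose N := maxn (size E) (size F).
rewrite !(@aty_widen N) ?leq_maxl ?leq_maxr //; last first.
  by rewrite (leq_trans (size_polyD _ _)) // size_polyN.
by rewrite -sumrB; apply: eq_bigr => k _; rewrite -scalerBl coefB.
Qed.
HB.instance Definition _ f := GRing.isZmodMorphism.Build _ _ (aty d f) (aty_is_additive f).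

Lemma atyC f c : aty d f c%:P = (c * f)%:P.
Proof.
rewrite (@aty_widen 1) ?size_polyC_leq1 // big_ord_recl big_ord0 addr0.
by rewrite coefC /= -mul_polyC polyCM.
Qed.

(** The product rule in y: f(y) d/dy E = d/dy (f(y) E) - f'(y) E, where
    multiplication by 'X is - d/dy. *)
Lemma atyMX f E : aty d f (E * 'X) = aty d f E * 'X + aty d (d f) E.
Proof.
have [->|E0] := eqVneq E 0; first by rewrite mul0r !raddf0 mul0r addr0.
rewrite (@aty_widen (size E).+1) ?size_mulX //.
rewrite !(@aty_widen (size E) _ E) // big_ord_recl coefMX eqxx /= scale0r add0r.
rewrite mulr_suml -big_split; apply: eq_bigr => k _.
rewrite coefMX /=.
by rewrite -iterS iterSr dxC iter_dxD iter_dxMX scalerDr addrC scalerAl.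
Qed.

Lemma atyDr f E F : aty d f (E + F) = aty d f E + aty d f F.
Proof. exact: raddfD. Qed.
Lemma aty0r f : aty d f 0 = 0.
Proof. exact: raddf0. Qed.
Lemma atyNr f E : aty d f (- E) = - aty d f E.
Proof. exact: raddfN. Qed.

Lemma atyDl f g E : aty d (f + g) E = aty d f E + aty d g E.
Proof.
elim/poly_ind: E f g => [|E c IHE] f g; first by rewrite !aty0r addr0.
rewrite 3!atyDr !atyMX !atyC (raddfD d) !IHE mulrDl mulrDr polyCD !addrA.
rewrite -!addrA; congr (_ + _); rewrite [in RHS](addrCA (c * f)%:P).
by rewrite [in RHS](addrCA (aty d (d f) E)) [in RHS](addrCA (c * f)%:P).
Qed.

Lemma dy_aty f E : dy (aty d f E) = aty d (d f) E + aty d f (dy E).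
Proof. by rewrite /dy atyNr atyMX opprD addrCA subrr addr0. Qed.

Lemma aty0l E : aty d 0 E = 0.
Proof. by apply: (addrI (aty d 0 E)); rewrite -atyDl !addr0. Qed.

Lemma aty1 E : d 1 = 0 -> aty d 1 E = E.
Proof.
move=> d1; elim/poly_ind: E => [|E c IHE]; first by rewrite aty0r.
by rewrite atyDr atyMX atyC IHE d1 mulr1 aty0l addr0.
Qed.

Lemma atyZr f c E : aty d f (c *: E) = c *: aty d f E.
Proof.
rewrite (@aty_widen (size E) f (c *: E)) ?size_scale_leq // (@aty_widen (size E)) //.
by rewrite scaler_sumr; apply: eq_bigr => k _; rewrite coefZ scalerA.
Qed.
End DiagonalCalculus.

Section Derivation.
Variables (V : comNzRingType) (d : {additive V -> V}).
Hypothesis dM : forall f g, d (f * g) = d f * g + f * d g.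
Implicit Types (E F : {poly V}) (f c : V).

Lemma dxZ f E : dx d (f *: E) = d f *: E + f *: dx d E.
Proof.
apply/polyP=> k; rewrite coef_dx [RHS]coefD !coefZ coef_dx dM mulrDr addrA; congr (_ + _).
by case: k => [|k]; rewrite ?mulr0 // coefZ.
Qed.

Lemma aty_dx f E : aty d f (dx d E) = dx d (aty d f E).
Proof.
elim/poly_ind: E f => [|E c IHE] f; first by rewrite !(raddf0, aty0r).
rewrite dxD dxMX dxC 2!atyDr 2!atyMX IHE IHE atyDr atyMX !atyC dxD dxD dxMX dxC.
by rewrite dM; ring.
Qed.

(** The exchange of x and y carries the coefficient f(y) to f(x).  This is what
    makes the left and right Leibniz rules mirror images of each other. *)
Lemma flip_aty f E : flip d (aty d f E) = f *: flip d E.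
Proof.
elim/poly_ind: E f => [|E c IHE] f; first by rewrite aty0r !flip0 scaler0.
rewrite atyDr atyMX atyC !flipD !flipMX !IHE dxZ !flipC -!mul_polyC; ring.
Qed.

Lemma flipZ f E : flip d (f *: E) = aty d f (flip d E).
Proof. by rewrite -[RHS](flipK d) flip_aty flipK. Qed.

Lemma atyM f g E : aty d (f * g) E = aty d f (aty d g E).
Proof.
elim/poly_ind: E f g => [|E c IHE] f g; first by rewrite !aty0r.
rewrite !(atyDr, atyMX, atyC) dM atyDl !IHE; ring.
Qed.

Lemma aty_const f E : d f = 0 -> aty d f E = f *: E.
Proof.
move=> df; elim/poly_ind: E => [|E c IHE]; first by rewrite aty0r scaler0.
by rewrite atyDr atyMX atyC IHE df aty0l addr0 -!mul_polyC; ring.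
Qed.
End Derivation.

(** * Distributions in three variables and the cyclic rotation *)

(** In {poly {poly V}} the outer variable 'X stands for - d/dy and the inner
    variable 'Y for - d/dz acting on delta(x - y) delta(x - z), so that
    [dx (dx d)] is d/dx.  Exchanging y and z is [swapXY], exchanging x and y is
    [flip (dx d)], and the rotation [cyc3] is their composite. *)
Section TwoVariables.
Local Opaque dx flip aty dy.
Variables (V : comNzRingType) (d : {additive V -> V}).
Hypothesis dM : forall f g, d (f * g) = d f * g + f * d g.
Implicit Types (E F : {poly {poly V}}) (f c : V).

Local Notation dx3 := (dx (dx d)).

Definition cyc3 E := flip (dx d) (swapXY E).

Lemma cyc3D E F : cyc3 (E + F) = cyc3 E + cyc3 F.
Proof. by rewrite /cyc3 raddfD flipD. Qed.
Lemma cyc3N E : cyc3 (- E) = - cyc3 E.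
Proof. by rewrite /cyc3 raddfN flipN. Qed.
Lemma cyc30 : cyc3 0 = 0.
Proof. by rewrite /cyc3 raddf0 flip0. Qed.

(** The rotation is additive, fixes f(x) delta(x - y) delta(x - z), and is
    known on multiples of 'X and 'Y; this principle is the induction to which
    that information is tailored. *)
Lemma polyXY_ind (K : {poly {poly V}} -> Prop) :
  (forall f, K f%:P%:P) -> (forall E F, K E -> K F -> K (E + F)) ->
  (forall E, K E -> K (E * 'X)) -> (forall E, K E -> K (E * 'Y)) -> forall E, K E.
Proof.
move=> KC KD KX KY E; elim/poly_ind: E => [|E c KE]; first exact: KC.
apply: (KD); first exact: KX.
elim/poly_ind: c => [|p f Kp]; first exact: KC 0.
by rewrite polyCD polyCM; apply: KD => //; apply: KY.
Qed.

Lemma dx3MY E : dx3 (E * 'Y) = dx3 E * 'Y.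
Proof.
apply/polyP=> k; rewrite coef_dx !coefMC coef_dx /= mulrDl dxMX; congr (_ + _).
by case: k => [|k]; rewrite ?mul0r // coefMC.
Qed.

Lemma flip3MY E : flip (dx d) (E * 'Y) = flip (dx d) E * 'Y.
Proof.
elim/poly_ind: E => [|E c IHE]; first by rewrite mul0r flip0 mul0r.
rewrite mulrDl mulrAC !flipD !flipMX IHE dx3MY -polyCM !flipC polyCM.
by ring.
Qed.

Lemma swap_dx3 E : swapXY (dx3 E) = dx3 (swapXY E).
Proof.
elim/polyXY_ind: E => [f|E F IHE IHF|E IHE|E IHE].
- rewrite [in RHS]swapXY_polyC map_polyC /= dxC /= dxC polyCD polyCM.
  rewrite !(rmorphD swapXY) !(rmorphM swapXY) /= swapXY_X swapXY_Y.
  by rewrite !swapXY_polyC !map_polyC /=; ring.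
- by rewrite dxD (raddfD swapXY) /= IHE IHF (raddfD swapXY) dxD.
- by rewrite dxMX (rmorphM swapXY) /= IHE (rmorphM swapXY) /= swapXY_X dx3MY.
- by rewrite dx3MY (rmorphM swapXY) /= IHE (rmorphM swapXY) /= swapXY_Y dxMX.
Qed.

(** If F(x, y, z) = E(y, z, x), then d/dx, d/dy, d/dz acting on E act on F as
    d/dy, d/dz, d/dx: this and the next two rules. *)
Lemma cyc3_dx E : cyc3 (dx3 E) = - (cyc3 E * 'X).
Proof. by rewrite /cyc3 swap_dx3 flip_dx dyE. Qed.

Lemma cyc3MX E : cyc3 (E * 'X) = cyc3 E * 'Y.
Proof. by rewrite /cyc3 rmorphM /= swapXY_X flip3MY. Qed.

Lemma cyc3MY E : cyc3 (E * 'Y) = - dx3 (cyc3 E).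
Proof. by rewrite /cyc3 rmorphM /= swapXY_Y flipMX. Qed.

Lemma cyc3C f : cyc3 f%:P%:P = f%:P%:P.
Proof. by rewrite /cyc3 swapXY_polyC map_polyC /= flipC. Qed.

(** The rotation permutes the three derivatives cyclically and fixes the
    distributions f(x) delta(x - y) delta(x - z); its cube commutes with the
    derivatives, hence is the identity. *)
Lemma cyc3K E : cyc3 (cyc3 (cyc3 E)) = E.
Proof.
elim/polyXY_ind: E => [f|E F IHE IHF|E IHE|E IHE].
- by rewrite !cyc3C.
- by rewrite !cyc3D IHE IHF.
- by rewrite cyc3MX cyc3MY cyc3N cyc3_dx opprK IHE.
- by rewrite cyc3MY !cyc3N cyc3_dx !cyc3N opprK cyc3MX IHE.
Qed.

Lemma cyc3_dz E : cyc3 (map_poly (@dy V) E) = dx3 (cyc3 E).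
Proof.
have -> : map_poly (@dy V) E = - (E * 'Y).
  apply/polyP=> k; rewrite coef_map_id0 ?coefN ?coefMC ?dyE //.
  by rewrite mul0r oppr0.
by rewrite cyc3N cyc3MY opprK.
Qed.

Lemma dx3Z f E : dx3 (f%:P *: E) = (d f)%:P *: E + f%:P *: dx3 E.
Proof.
apply/polyP=> k; rewrite coef_dx [RHS]coefD !coefZ coef_dx /=.
have -> : dx d (f%:P * E`_k) = (d f)%:P * E`_k + f%:P * dx d E`_k.
  by rewrite !mul_polyC dxZ.
rewrite (mulrDr _ (dx d _)) addrA; congr (_ + _).
by case: k => [|k]; rewrite ?mulr0 ?coefZ.
Qed.

Lemma flip3_map f (c : {poly V}) :
  flip (dx d) (map_poly polyC (aty d f c)) = f%:P *: flip (dx d) (map_poly polyC c).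
Proof.
elim/poly_ind: c f => [|q g IHq] f.
  by rewrite aty0r map_poly0 flip0 scaler0.
rewrite atyDr atyMX atyC !(rmorphD, rmorphM) /= !map_polyX !map_polyC /=.
rewrite !flipD !flipMX !IHq dx3Z flipC -polyCM flipC -!mul_polyC polyCM; ring.
Qed.

(** The third argument moves to the first place, so a coefficient at z becomes
    an ordinary coefficient. *)
Lemma cyc3_atz f E : cyc3 (map_poly (aty d f) E) = f%:P *: cyc3 E.
Proof.
elim/poly_ind: E => [|E c IHE]; first by rewrite map_poly0 cyc30 scaler0.
rewrite (raddfD (map_poly (aty d f))) /= map_additiveMX map_additiveC /=.
rewrite !cyc3D !cyc3MX IHE scalerDr scalerAl; congr (_ + _).
by rewrite /cyc3 !swapXY_polyC flip3_map.
Qed.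

(** In the symmetric group on the three points, a transposition followed by a
    rotation is the transposition of y and z. *)
Lemma cyc3_swap E : cyc3 (cyc3 (flip (dx d) E)) = swapXY E.
Proof.
rewrite -[RHS]cyc3K; congr (cyc3 (cyc3 _)).
by rewrite /cyc3 swapXYK.
Qed.
End TwoVariables.

(** * Algebras of differential functions and modules over them *)

Lemma fsum_jets (I : finType) (M : nmodType) (F : I * nat -> M) N :
  (forall a, (N <= a.2)%N -> F a = 0) ->
  \sum_(a \in [set: I * nat]) F a = \sum_(i : I) \sum_(n < N) F (i, val n).
Proof.
move=> F0.
rewrite (@fsbigE _ _ _ _ _ [seq (i, n) | i <- enum I, n <- iota 0 N]); first last.
- move=> -[i n] _; apply: contraNeq => Fn0.
  apply/allpairsP; exists (i, n); split=> //=; first by rewrite mem_enum.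
  by rewrite mem_iota /= add0n ltnNge; apply: contraNN Fn0 => le; apply/eqP/F0.
- by [].
- by apply: allpairs_uniq => [||[? ?] [? ?]] //; rewrite ?enum_uniq ?iota_uniq.
rewrite (eq_bigl xpredT); last by move=> a; rewrite in_setT.
rewrite big_allpairs_dep /= big_enum; apply: eq_bigr => i _.
by rewrite -[N]subn0 -[LHS]/(\sum_(0 <= n < N) F (i, n)) big_mkord subn0.
Qed.

Section Derivative.
Variables (I : finType) (V : comNzRingType) (d : {additive V -> V}).
Variables (pd : I * nat -> {additive V -> V}) (x : I * nat -> V).

(** The formal properties of functions of the jets u_i^{(n)}, indexed by (i, n):
    partial derivatives [pd], total derivative [d], coordinates [x].  The two
    rules [df_pd0] and [df_pdS] say that [pd (i, n.+1), d] = pd (i, n). *)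
Record differential_functions : Prop := {
  df_dM : forall f g, d (f * g) = d f * g + f * d g;
  df_pdM : forall a f g, pd a (f * g) = pd a f * g + f * pd a g;
  df_pdC : forall a b f, pd a (pd b f) = pd b (pd a f);
  df_pd0 : forall i f, pd (i, 0%N) (d f) = d (pd (i, 0%N) f);
  df_pdS : forall i n f, pd (i, n.+1) (d f) = d (pd (i, n.+1) f) + pd (i, n) f;
  df_fin : forall f, exists N, forall a, (N <= a.2)%N -> pd a f = 0;
  df_x : forall a b, pd a (x b) = (a == b)%:R;
  df_dx : forall i n, d (x (i, n)) = x (i, n.+1) }.

(** A module M over a differential ring whose derivative is lifted to L.
    Distributions are such modules in several ways: with the coefficients taken
    at x, y or z and L the derivative in the same variable. *)
Record connection (M : zmodType) (act : V -> M -> M) (L : M -> M) : Prop := {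
  cn_Dl : forall f g m, act (f + g) m = act f m + act g m;
  cn_Dr : forall f m n, act f (m + n) = act f m + act f n;
  cn_M : forall f g m, act (f * g) m = act f (act g m);
  cn_1 : forall m, act 1 m = m;
  cn_LD : forall m n, L (m + n) = L m + L n;
  cn_L : forall f m, L (act f m) = act (d f) m + act f (L m) }.

(** The chain rule for the derivation that carries u_i to G_i and [d] to L.
    Brackets with one argument fixed are of this form. *)
Definition der (M : zmodType) (act : V -> M -> M) (L : M -> M) (G : I -> M)
    (A : V) : M :=
  \sum_(a \in [set: I * nat]) act (pd a A) (iter a.2 L (G a.1)).

Hypothesis dfV : differential_functions.

Lemma df_bound2 A B : exists N,
  (forall a, (N <= a.2)%N -> pd a A = 0) /\ (forall a, (N <= a.2)%N -> pd a B = 0).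
Proof.
have [[N hN] [N' hN']] := (df_fin dfV A, df_fin dfV B).
exists (maxn N N'); split=> a; rewrite geq_max => /andP[le le'].
  exact: hN.
exact: hN'.
Qed.

Section Der.
Variables (M : zmodType) (act : V -> M -> M) (L : M -> M).
Hypothesis cn : connection act L.

Lemma cn_0l m : act 0 m = 0.
Proof. by apply: (addrI (act 0 m)); rewrite -(cn_Dl cn) !addr0. Qed.
Lemma cn_0r f : act f 0 = 0.
Proof. by apply: (addrI (act f 0)); rewrite -(cn_Dr cn) !addr0. Qed.
Lemma cn_Nr f m : act f (- m) = - act f m.
Proof. by apply: (addrI (act f m)); rewrite -(cn_Dr cn) !subrr cn_0r. Qed.
Lemma cn_L0 : L 0 = 0.
Proof. by apply: (addrI (L 0)); rewrite -(cn_LD cn) !addr0. Qed.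
Lemma cn_LN m : L (- m) = - L m.
Proof. by apply: (addrI (L m)); rewrite -(cn_LD cn) !subrr cn_L0. Qed.
Lemma cn_sumr (J : finType) f (F : J -> M) :
  act f (\sum_j F j) = \sum_j act f (F j).
Proof. by apply: (big_morph (act f)) => [m n|]; rewrite ?(cn_Dr cn) ?cn_0r. Qed.
Lemma cn_Lsum (J : finType) (F : J -> M) : L (\sum_j F j) = \sum_j L (F j).
Proof. by apply: (big_morph L) => [m n|]; rewrite ?(cn_LD cn) ?cn_L0. Qed.
Lemma cn_iterD n m m' : iter n L (m + m') = iter n L m + iter n L m'.
Proof. by elim: n => //= n ->; rewrite (cn_LD cn). Qed.
Lemma cn_iterN n m : iter n L (- m) = - iter n L m.
Proof. by elim: n => //= n ->; rewrite cn_LN. Qed.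

Lemma derE N G A : (forall a, (N <= a.2)%N -> pd a A = 0) ->
  der act L G A = \sum_i \sum_(n < N) act (pd (i, val n) A) (iter n L (G i)).
Proof. by move=> A0; rewrite /der (@fsum_jets _ _ _ N) // => a /A0->; rewrite cn_0l. Qed.

Lemma derD G A B : der act L G (A + B) = der act L G A + der act L G B.
Proof.
have [N [A0 B0]] := df_bound2 A B.
have AB0 a : (N <= a.2)%N -> pd a (A + B) = 0.
  by move=> le; rewrite raddfD A0 ?B0 ?addr0.
rewrite !(@derE N) // -big_split; apply: eq_bigr => i _ /=.
by rewrite -big_split; apply: eq_bigr => n _ /=; rewrite raddfD (cn_Dl cn).
Qed.

Lemma der0 G : der act L G 0 = 0.
Proof. by apply: (addrI (der act L G 0)); rewrite -derD !addr0. Qed.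

Lemma derN G A : der act L G (- A) = - der act L G A.
Proof. by apply: (addrI (der act L G A)); rewrite -derD !subrr der0. Qed.

Lemma derM G A B :
  der act L G (A * B) = act A (der act L G B) + act B (der act L G A).
Proof.
have [N [A0 B0]] := df_bound2 A B.
have AB0 a : (N <= a.2)%N -> pd a (A * B) = 0.
  by move=> le; rewrite (df_pdM dfV) A0 ?B0 // mul0r mulr0 addr0.
rewrite !(@derE N) // !cn_sumr -big_split; apply: eq_bigr => i _ /=.
rewrite !cn_sumr -big_split; apply: eq_bigr => n _ /=.
by rewrite (df_pdM dfV) (mulrC (pd _ A)) (cn_Dl cn) addrC !(cn_M cn).
Qed.

(** The commutator of [pd (i, n.+1)] and d is [pd (i, n)], which matches
    L (L^n G_i) = L^(n+1) G_i: both sides are the same sum shifted by one. *)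
Lemma der_d G A : der act L G (d A) = L (der act L G A).
Proof.
have [N A0] := df_fin dfV A.
have dA0 a : (N.+1 <= a.2)%N -> pd a (d A) = 0.
  case: a => i [//|n] /= le; rewrite (df_pdS dfV) !A0 ?raddf0 ?addr0 //.
  exact: leqW.
rewrite (derE _ dA0) (derE _ A0) cn_Lsum; apply: eq_bigr => i _.
rewrite cn_Lsum big_ord_recl /= (df_pd0 dfV).
under eq_bigr => n _ do rewrite /bump /= add1n (df_pdS dfV) (cn_Dl cn).
under [in RHS]eq_bigr => n _ do rewrite (cn_L cn).
rewrite !big_split /= addrA; congr (_ + _).
case: N A0 {dA0} => [|N] A0; first by rewrite !big_ord0 addr0 A0 // raddf0 cn_0l.
rewrite big_ord_recr /= (A0 (i, N.+1)) // raddf0 cn_0l addr0 [RHS]big_ord_recl /=.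
by congr (_ + _); apply: eq_bigr => n _; rewrite /bump /= add1n.
Qed.

Lemma der_x G i : der act L G (x (i, 0%N)) = G i.
Proof.
have x0 a : (1 <= a.2)%N -> pd a (x (i, 0%N)) = 0.
  by rewrite (df_x dfV); case: a => j [|n] //= _; rewrite xpair_eqE andbF.
rewrite (derE _ x0) (bigD1 i) //= big_ord_recl big_ord0 addr0 /= (df_x dfV) eqxx.
rewrite (cn_1 cn) big1 ?addr0 // => j ji.
rewrite big_ord_recl big_ord0 addr0 /= (df_x dfV) xpair_eqE (negPf ji).
exact: cn_0l.
Qed.

Lemma der_const G c : (forall a, pd a c = 0) -> der act L G c = 0.
Proof. by move=> c0; rewrite (@derE 0) // big1 // => i _; rewrite big_ord0. Qed.

Lemma eq_der G G' A : G =1 G' -> der act L G A = der act L G' A.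
Proof. by move=> /funext->. Qed.

Lemma der_addG G G' A :
  der act L (fun i => G i + G' i) A = der act L G A + der act L G' A.
Proof.
have [N A0] := df_fin dfV A.
rewrite !(derE _ A0) -big_split; apply: eq_bigr => i _ /=.
by rewrite -big_split; apply: eq_bigr => n _ /=; rewrite cn_iterD (cn_Dr cn).
Qed.

Lemma der_oppG G A : der act L (fun i => - G i) A = - der act L G A.
Proof.
have [N A0] := df_fin dfV A.
rewrite !(derE _ A0) -sumrN; apply: eq_bigr => i _ /=.
by rewrite -sumrN; apply: eq_bigr => n _ /=; rewrite cn_iterN cn_Nr.
Qed.

Lemma der_zeroG A : der act L (fun=> 0) A = 0.
Proof.
have [N A0] := df_fin dfV A.
rewrite (derE _ A0) big1 // => i _; rewrite big1 // => n _.
suff -> : iter n L 0 = 0 by rewrite cn_0r.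
by elim: (val n) => //= k ->; rewrite cn_L0.
Qed.
End Der.

(** The symmetries of distributions exchange the module structures at x, y and z;
    this is how they act on brackets. *)
Lemma der_morph (M M' : zmodType) (act : V -> M -> M) L (act' : V -> M' -> M') L'
    (phi : M -> M') G A :
  connection act L -> connection act' L' ->
  (forall m n, phi (m + n) = phi m + phi n) ->
  (forall f m, phi (act f m) = act' f (phi m)) ->
  (forall m, phi (L m) = L' (phi m)) ->
  phi (der act L G A) = der act' L' (phi \o G) A.
Proof.
move=> cn cn' phiD phiZ phiL; have [N A0] := df_fin dfV A.
have phi0 : phi 0 = 0 by apply: (addrI (phi 0)); rewrite -phiD !addr0.
rewrite (derE cn _ A0) (derE cn' _ A0) (big_morph phi phiD phi0).
apply: eq_bigr => i _; rewrite (big_morph phi phiD phi0); apply: eq_bigr => n _.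
by rewrite phiZ; congr act'; elim: (val n) => //= k <-.
Qed.

End Derivative.

(** * The bracket generated by a matrix of distributions *)

Section GeneralBracket.
Local Opaque dx flip aty dy.
Variables (I : finType) (V : comNzRingType) (d : {additive V -> V}).
Variables (pd : I * nat -> {additive V -> V}) (x : I * nat -> V).
Hypothesis dfV : differential_functions d pd x.
Let dM := df_dM dfV.

Lemma connection_x : connection d (fun f E => f *: E) (dx d).
Proof.
split=> *.
- exact: scalerDl.
- exact: scalerDr.
- by rewrite scalerA.
- exact: scale1r.
- exact: dxD.
- exact: dxZ.
Qed.

Lemma derivation1 : d 1 = 0.
Proof. by apply: (addrI (d 1)); rewrite addr0 -{3}[1]mulr1 dM mulr1 mul1r. Qed.

Lemma dyD (E F : {poly V}) : dy (E + F) = dy E + dy F.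
Proof. by rewrite !dyE mulrDl opprD. Qed.

Lemma connection_y : connection d (aty d) (@dy V).
Proof.
split=> *.
- exact: atyDl.
- exact: atyDr.
- exact: atyM.
- exact: aty1 derivation1.
- exact: dyD.
- exact: dy_aty.
Qed.

Lemma connection_x3 :
  connection d (fun f (E : {poly {poly V}}) => f%:P *: E) (dx (dx d)).
Proof.
split=> *.
- by rewrite polyCD scalerDl.
- exact: scalerDr.
- by rewrite polyCM scalerA.
- by rewrite scale1r.
- exact: dxD.
- exact: dx3Z.
Qed.

Lemma coef_map_dy (E : {poly {poly V}}) k : (map_poly (@dy V) E)`_k = dy E`_k.
Proof. by rewrite coef_map_id0 // dyE mul0r oppr0. Qed.

Lemma connection_z :
  connection d (fun f (E : {poly {poly V}}) => map_poly (aty d f) E) (map_poly (@dy V)).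
Proof.
split=> *; apply/polyP=> k;
  rewrite ?(coefD, coef_map_additive, coef_map_dy) /= ?(coefD, coef_map_additive, coef_map_dy) /=.
- exact: atyDl.
- exact: atyDr.
- exact: atyM.
- exact: aty1 derivation1.
- exact: dyD.
- exact: dy_aty.
Qed.

Local Notation derx := (der pd (fun f E => f *: E) (dx d)).
Local Notation dery := (der pd (aty d) (@dy V)).
Local Notation derx3 := (der pd (fun f (E : {poly {poly V}}) => f%:P *: E) (dx (dx d))).
Local Notation derz :=
  (der pd (fun f (E : {poly {poly V}}) => map_poly (aty d f) E) (map_poly (@dy V))).

(** The definition of [bracket] over an arbitrary ring; [bracket] is the
    instance of it at the ring of all functions on the jet space. *)
Definition formal_bracket (D : V -> V) (pD : I * nat -> V -> V)
    (P : I -> I -> {poly V}) (A B : V) : {poly V} :=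
  \sum_(a \in [set: I * nat]) \sum_(b \in [set: I * nat])
    pD a A *: aty D (pD b B) (iter a.2 (dx D) (iter b.2 (@dy V) (P a.1 b.1))).

(** Deriving B at y and then A at x makes additivity, the Leibniz rule and the
    compatibility with d in A instances of [derD], [derM] and [der_d]. *)
Definition br (P : I -> I -> {poly V}) (A B : V) : {poly V} :=
  derx (fun i => dery (P i) B) A.

Lemma dx_dy (E : {poly V}) : dx d (dy E) = dy (dx d E).
Proof. by rewrite !dyE dxN dxMX. Qed.

Lemma iter_dx_dy n m (E : {poly V}) :
  iter n (dx d) (iter m (@dy V) E) = iter m (@dy V) (iter n (dx d) E).
Proof.
elim: n => //= n ->; elim: m => //= m <-; exact: dx_dy.
Qed.

Lemma dery_iter_dx n G B : iter n (dx d) (dery G B) = dery (fun i => iter n (dx d) (G i)) B.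
Proof.
elim: n => //= n ->.
rewrite (der_morph dfV (L' := @dy V) (act' := aty d) _ _ connection_y connection_y) //.
- exact: dxD.
- by move=> f m; rewrite aty_dx.
- exact: dx_dy.
Qed.

Lemma dery_scale f G B : f *: dery G B = dery (fun i => f *: G i) B.
Proof.
rewrite (der_morph dfV (L' := @dy V) (act' := aty d) (phi := fun E => f *: E)
  _ _ connection_y connection_y) //.
- exact: scalerDr.
- by move=> g m; rewrite atyZr.
- by move=> m; rewrite !dyE scalerN scalerAl.
Qed.

Lemma formal_bracketE P A B : formal_bracket d pd P A B = br P A B.
Proof.
rewrite /formal_bracket /br /der; apply: eq_fsbigr => a _.
rewrite dery_iter_dx dery_scale; apply: eq_fsbigr => b _.
rewrite -atyZr iter_dx_dy; congr aty.
by elim: b.2 => //= n <-; rewrite !dyE scalerN scalerAl.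
Qed.

(** The two derivations act on different variables, hence commute; the
    properties in the second argument follow from those of [der] as well. *)
Lemma br_swap P A B : br P A B = dery (fun j => derx (fun i => P i j) A) B.
Proof.
have [N A0] := df_fin dfV A.
rewrite /br (derE connection_x _ A0).
under [in RHS]eq_der => j do rewrite (derE connection_x _ A0).
have dery_sum (J : finType) (F : J -> I -> {poly V}) :
    dery (fun j => \sum_k F k j) B = \sum_k dery (F k) B.
  transitivity (dery (\sum_k F k) B).
    by apply: eq_der => j; rewrite fct_sumE.
  apply: (big_morph (fun G => dery G B)) => [G G'|].
    by rewrite -(der_addG dfV connection_y).
  by rewrite -[RHS](der_zeroG dfV connection_y B).
rewrite dery_sum; apply: eq_bigr => i _.
rewrite dery_sum; apply: eq_bigr => n _.
by rewrite dery_iter_dx dery_scale.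
Qed.

Lemma brDl P A B E : br P (A + B) E = br P A E + br P B E.
Proof. exact: (derD dfV connection_x). Qed.
Lemma brDr P A B E : br P E (A + B) = br P E A + br P E B.
Proof. by rewrite !br_swap; apply: (derD dfV connection_y). Qed.
Lemma brMl P A B E : br P (A * B) E = A *: br P B E + B *: br P A E.
Proof. exact: (derM dfV connection_x). Qed.
Lemma brMr P A B E : br P E (A * B) = aty d A (br P E B) + aty d B (br P E A).
Proof. by rewrite !br_swap; apply: (derM dfV connection_y). Qed.
Lemma br_dl P A B : br P (d A) B = dx d (br P A B).
Proof. exact: (der_d dfV connection_x). Qed.
Lemma br_dr P A B : br P A (d B) = dy (br P A B).
Proof. by rewrite !br_swap; apply: (der_d dfV connection_y). Qed.
Lemma br_constl P c A B : (forall a, pd a c = 0) -> br P (c * A) B = c *: br P A B.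
Proof. by move=> c0; rewrite brMl [br P c B](der_const connection_x) // scaler0 addr0. Qed.
Lemma br_constr P c A B : (forall a, pd a c = 0) -> d c = 0 -> br P A (c * B) = c *: br P A B.
Proof.
move=> c0 dc; rewrite brMr aty_const // [br P A c]br_swap.
by rewrite (der_const connection_y) // aty0r addr0.
Qed.
Lemma br_xl P i B : br P (x (i, 0%N)) B = dery (P i) B.
Proof. exact: (der_x dfV connection_x). Qed.
Lemma br_xr P j A : br P A (x (j, 0%N)) = derx (fun i => P i j) A.
Proof. by rewrite br_swap; apply: (der_x dfV connection_y). Qed.
Lemma br_x P i j : br P (x (i, 0%N)) (x (j, 0%N)) = P i j.
Proof. rewrite br_xl; exact: (der_x dfV connection_y). Qed.

Lemma brN P A B : br P (- A) B = - br P A B.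
Proof. exact: (derN dfV connection_x). Qed.

Variable P : I -> I -> {poly V}.
Hypothesis skewP : forall i j, P i j = - flip d (P j i).

(** [flip] intertwines the derivations at x and at y, so that both sides are
    the same double derivation with values given on the fields. *)
Lemma br_anticomm A B : br P A B = - flip d (br P B A).
Proof.
have flip_dery G C : flip d (dery G C) = derx (fun i => flip d (G i)) C.
  rewrite (der_morph dfV _ _ connection_y connection_x) //; last exact: flip_dy.
  - exact: flipD.
  - exact: flip_aty.
have flip_derx G C : flip d (derx G C) = dery (fun i => flip d (G i)) C.
  rewrite (der_morph dfV _ _ connection_x connection_y) //; last exact: flip_dx.
  - exact: flipD.
  - exact: flipZ.
rewrite br_swap [br P B A]/br flip_derx -(der_oppG dfV connection_y).
apply: eq_der => j; rewrite flip_dery -(der_oppG dfV connection_x).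
by apply: eq_der => i; rewrite skewP.
Qed.

Definition br3 A B E : {poly {poly V}} := map_poly (fun c => br P c E) (br P A B).

Definition jacobiator A B E :=
  br3 A B E + cyc3 d (br3 B E A) + cyc3 d (cyc3 d (br3 E A B)).

(** A rotation of order three permutes the three terms. *)
Lemma jacobiator_cyc A B E : cyc3 d (jacobiator B E A) = jacobiator A B E.
Proof. by rewrite /jacobiator !cyc3D cyc3K // addrC addrA. Qed.

Lemma br0 E : br P 0 E = 0.
Proof. exact: (der0 dfV connection_x). Qed.

Lemma coef_br3 (G : {poly V}) E k : (map_poly (fun c => br P c E) G)`_k = br P G`_k E.
Proof. by rewrite coef_map_id0 // br0. Qed.

Lemma map_brD (G G' : {poly V}) E :
  map_poly (fun c => br P c E) (G + G') =
  map_poly (fun c => br P c E) G + map_poly (fun c => br P c E) G'.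
Proof. by apply/polyP=> k; rewrite !(coefD, coef_br3) brDl. Qed.

Lemma map_brN (G : {poly V}) E :
  map_poly (fun c => br P c E) (- G) = - map_poly (fun c => br P c E) G.
Proof. by apply/polyP=> k; rewrite !(coefN, coef_br3) brN. Qed.

(** In {f(x) G(x, y), E(z)} the coefficient f depends on the fields too; the
    term where it is the one that is differentiated produces the cross terms of
    [br3_expand]. *)
Lemma map_brZ f (G : {poly V}) E :
  map_poly (fun c => br P c E) (f *: G) =
  (br P f E)%:P * G^:P + f%:P *: map_poly (fun c => br P c E) G.
Proof.
apply/polyP=> k; rewrite coefD coefCM coefZ !coef_br3 coefZ coef_map /= brMl.
by rewrite addrC mul_polyC mulrC mul_polyC.
Qed.

Lemma map_br_dx (G : {poly V}) E :
  map_poly (fun c => br P c E) (dx d G) = dx (dx d) (map_poly (fun c => br P c E) G).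
Proof.
apply/polyP=> k; rewrite [RHS]coef_dx !coef_br3 coef_dx brDl br_dl /=; congr (_ + _).
by case: k => [|k]; rewrite ?br0 ?coef_br3.
Qed.

Lemma map_br_iter_dx n (G : {poly V}) E :
  map_poly (fun c => br P c E) (iter n (dx d) G) =
  iter n (dx (dx d)) (map_poly (fun c => br P c E) G).
Proof. by elim: n => //= n <-; rewrite map_br_dx. Qed.

Lemma map_br_flip (G : {poly V}) E :
  map_poly (fun c => br P c E) (flip d G) = flip (dx d) (map_poly (fun c => br P c E) G).
Proof.
have mapC c : map_poly (fun c => br P c E) c%:P = (br P c E)%:P.
  by apply/polyP=> k; rewrite coef_br3 !coefC; case: eqP; rewrite ?br0.
have mapMX (F : {poly V}) :
    map_poly (fun c => br P c E) (F * 'X) = map_poly (fun c => br P c E) F * 'X.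
  by apply/polyP=> k; rewrite coef_br3 !coefMX; case: eqP => _; rewrite ?br0 ?coef_br3.
elim/poly_ind: G => [|G c IHG]; first by rewrite flip0 map_poly0 flip0.
rewrite flipD map_brD flipMX flipC map_brN map_br_dx IHG mapC.
by rewrite map_brD mapMX mapC flipD flipMX flipC.
Qed.

(** Bracketing with E(z) involves x and y only through the coefficients and
    through d/dx, so it commutes with the exchange of x and y. *)
Lemma br3_anticomm A B E : br3 E A B = - flip (dx d) (br3 A E B).
Proof. by rewrite /br3 br_anticomm map_brN map_br_flip. Qed.

(** The Jacobi identity in the form {{A, B}, E} - {{A, E}, B} + {{B, E}, A}, in
    which the first argument of the first two terms is A. *)
Lemma jacobiatorE A B E : jacobiator A B E = br3 A B E - swapXY (br3 A E B) + cyc3 d (br3 B E A).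
Proof.
by rewrite /jacobiator (br3_anticomm A B E) !cyc3N cyc3_swap // addrAC.
Qed.

(** Second derivatives of A; G enters with the pair (x, y), that is with the
    outer variable, and H with the pair (x, z). *)
Definition cross N A (G H : I -> {poly V}) : {poly {poly V}} :=
  \sum_(p : I * 'I_N) \sum_(q : I * 'I_N)
    (pd (q.1, val q.2) (pd (p.1, val p.2) A) *: iter q.2 (dx d) (H q.1))%:P *
    (iter p.2 (dx d) (G p.1))^:P.

(** Symmetry of the second derivatives of A. *)
Lemma swap_cross N A G H : swapXY (cross N A G H) = cross N A H G.
Proof.
rewrite /cross rmorph_sum /= [RHS]exchange_big; apply: eq_bigr => p _ /=.
rewrite rmorph_sum /=; apply: eq_bigr => q _.
rewrite rmorphM /= swapXY_polyC swapXY_map_polyC (df_pdC dfV).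
by rewrite -!mul_polyC polyCM !rmorphM /= map_polyC /= mulrC mulrCA mulrA.
Qed.

(** Differentiating {A, B} = \sum_p dA/du_p d_x^n {u_p, B} once more, either
    the factor {u_p, B} or the coefficient dA/du_p is hit; only the latter
    involves second derivatives of A. *)
Lemma br3_expand A : exists N, forall B E,
  br3 A B E = cross N A (fun i => br P (x (i, 0%N)) B) (fun i => br P (x (i, 0%N)) E)
    + derx3 (fun i => br3 (x (i, 0%N)) B E) A.
Proof.
have [N A0] := df_fin dfV A; exists N => B E.
rewrite /br3 [br P A B]/br (derE connection_x _ A0) (derE connection_x3 _ A0) !pair_bigA /=.
rewrite (big_morph (fun G => map_poly (fun c => br P c E) G)
  (fun G G' => map_brD G G' E) (map_poly0 _)).
rewrite -big_split; apply: eq_bigr => p _ /=.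
rewrite map_brZ map_br_iter_dx -!br_xl; congr (_ + _).
rewrite {1}/br (derE connection_x (N := N)); last first.
  by move=> a le; rewrite (df_pdC dfV) A0 // raddf0.
rewrite pair_bigA /= rmorph_sum mulr_suml; apply: eq_bigr => q _ /=.
by rewrite -br_xl.
Qed.

Lemma derx3_swap G A : swapXY (derx3 G A) = derx3 (fun i => swapXY (G i)) A.
Proof.
rewrite (der_morph dfV (phi := swapXY) _ _ connection_x3 connection_x3) //.
- exact: raddfD.
- by move=> f m; rewrite -!mul_polyC rmorphM /= swapXY_polyC map_polyC.
- exact: swap_dx3.
Qed.

(** Here A is the outermost argument of the double bracket, so it is never
    differentiated twice. *)
Lemma cyc_br3 A B E :
  cyc3 d (br3 B E A) = derx3 (fun i => cyc3 d (br3 B E (x (i, 0%N)))) A.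
Proof.
have -> : br3 B E A = derz (fun i => br3 B E (x (i, 0%N))) A.
  apply/polyP=> k; rewrite coef_br3 br_swap.
  rewrite (der_morph dfV (phi := fun F : {poly {poly V}} => F`_k) _ _ connection_z connection_y).
  - by apply: eq_der => j /=; rewrite coef_br3 br_xr.
  - by move=> F F'; rewrite coefD.
  - by move=> f F; rewrite coef_map_additive.
  - by move=> F; rewrite coef_map_dy.
rewrite (der_morph dfV (phi := cyc3 d) _ _ connection_z connection_x3) //.
- exact: cyc3D.
- exact: cyc3_atz.
- exact: cyc3_dz.
Qed.

(** The second derivatives of A in {{A, B}, E} and {{A, E}, B} are exchanged by
    swapping y and z, hence cancel; what is left is a derivation in A. *)
Lemma jacobiator_der A B E : jacobiator A B E = derx3 (fun i => jacobiator (x (i, 0%N)) B E) A.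
Proof.
have [N expand] := br3_expand A.
rewrite jacobiatorE !expand (raddfD swapXY) /= swap_cross derx3_swap opprD addrACA subrr add0r.
rewrite -(der_oppG dfV connection_x3) -(der_addG dfV connection_x3) cyc_br3.
rewrite -(der_addG dfV connection_x3); apply: eq_der => i.
by rewrite jacobiatorE.
Qed.

(** The jacobiator is a derivation in its first argument, and the rotation
    brings each argument to the first place. *)
Lemma jacobiator_from_fields :
  (forall i j k, jacobiator (x (i, 0%N)) (x (j, 0%N)) (x (k, 0%N)) = 0) ->
  forall A B E, jacobiator A B E = 0.
Proof.
move=> J0.
have step B E : (forall i, jacobiator (x (i, 0%N)) B E = 0) ->
    forall A, jacobiator A B E = 0.
  move=> H A; rewrite jacobiator_der -[RHS](der_zeroG dfV connection_x3 A).
  exact: eq_der.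
have rot A B E : jacobiator B E A = 0 -> jacobiator A B E = 0.
  by move=> H; rewrite -jacobiator_cyc H cyc30.
move=> A B E; apply: (step) => i; apply: (rot); apply: (step) => j {B}.
apply: (rot); apply: (step) => k {E}.
exact: J0.
Qed.

End GeneralBracket.

(** * Brackets of hydrodynamic type *)

Section Hydrodynamic.
Local Opaque dx flip aty dy.
Variables (I : finType) (V : comNzRingType) (d : {additive V -> V}).
Variables (pd : I * nat -> {additive V -> V}) (x : I * nat -> V).
Hypothesis dfV : differential_functions d pd x.
Let dM := df_dM dfV.
Variables g h : I -> I -> V.

Definition hydro i j : {poly V} := (h i j)%:P + g i j *: 'X.

Lemma flip_hydro i j : flip d (hydro i j) = (h i j - d (g i j))%:P - g i j *: 'X.
Proof.
rewrite /hydro -mul_polyC flipD flipC flipMX flipC dxC polyCB.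
by rewrite opprD addrA.
Qed.

(** The adjoint of h + g d_x is (h - g') - g d_x. *)
Lemma hydro_skew :
  (forall i j, g i j = g j i) -> (forall i j, h i j + h j i = d (g i j)) ->
  forall i j, hydro i j = - flip d (hydro j i).
Proof.
move=> gC hD i j; rewrite flip_hydro -(gC i j) -(hD i j) /hydro opprB addrC.
by congr (_ + _); rewrite -polyCN; congr (_%:P); ring.
Qed.

(** The coefficients of delta, delta', delta'' in {c(x), u_k(y)} when c involves
    no derivative of the fields beyond the first. *)
Definition hyd0 c k := \sum_s (pd (s, 0%N) c * h s k + pd (s, 1%N) c * d (h s k)).
Definition hyd1 c k :=
  \sum_s (pd (s, 0%N) c * g s k + pd (s, 1%N) c * (d (g s k) + h s k)).
Definition hyd2 c k := \sum_s pd (s, 1%N) c * g s k.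

Lemma br_hydro c k : (forall s n, pd (s, n.+2) c = 0) ->
  br d pd hydro c (x (k, 0%N)) =
  (hyd0 c k)%:P + (hyd1 c k)%:P * 'X + (hyd2 c k)%:P * 'X^2.
Proof.
move=> c2; rewrite (br_xr dfV) (derE (connection_x dfV) (N := 2)); last first.
  by move=> [s [|[|n]]] //= _; rewrite c2.
rewrite /hyd0 /hyd1 /hyd2 !rmorph_sum /= !mulr_suml -!big_split; apply: eq_bigr => s _.
rewrite !big_ord_recl big_ord0 /= /bump /= /hydro -!mul_polyC dxD dxMX !dxC !rmorphD !rmorphM /=.
ring.
Qed.

Lemma br3_hydro i j k :
  (forall s n, pd (s, n.+2) (h i j) = 0) -> (forall s n, pd (s, n.+1) (g i j) = 0) ->
  br3 d pd hydro (x (i, 0%N)) (x (j, 0%N)) (x (k, 0%N)) =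
  (hyd0 (h i j) k)%:P%:P + (hyd1 (h i j) k)%:P%:P * 'Y + (hyd2 (h i j) k)%:P%:P * 'Y * 'Y
  + ((hyd0 (g i j) k)%:P%:P + (hyd1 (g i j) k)%:P%:P * 'Y) * 'X.
Proof.
move=> h2 g1; rewrite /br3 (br_x dfV) /hydro -mul_polyC (map_brD dfV).
have br0' : br d pd hydro 0 (x (k, 0%N)) = 0 by exact: (br0 dfV).
have -> c : map_poly (fun c => br d pd hydro c (x (k, 0%N))) c%:P =
    (br d pd hydro c (x (k, 0%N)))%:P.
  by apply/polyP=> m; rewrite (coef_br3 dfV) !coefC; case: eqP; rewrite ?br0'.
have -> c : map_poly (fun c => br d pd hydro c (x (k, 0%N))) (c%:P * 'X) =
    (br d pd hydro c (x (k, 0%N)))%:P * 'X.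
  by apply/polyP=> m; rewrite (coef_br3 dfV) !coefMX !coefC; case: m => [|[|m]] //=; rewrite ?br0'.
rewrite !br_hydro //.
have -> : hyd2 (g i j) k = 0 by rewrite /hyd2 big1 // => s _; rewrite g1 mul0r.
rewrite polyC0 mul0r addr0 !polyCD !polyCM; ring.
Qed.

(** For a bracket of hydrodynamic type the jacobiator of three fields has order
    at most two in delta^{(k)}(x - y) delta^{(l)}(x - z), k + l <= 2.  The six
    hypotheses are the vanishing of its six coefficients; the subtracted
    derivatives come from rotating the third term back to coefficients at x. *)
Lemma jacobiator_hydro i j k :
  (forall i j s n, pd (s, n.+2) (h i j) = 0) -> (forall i j s n, pd (s, n.+1) (g i j) = 0) ->
  (forall i j, hydro i j = - flip d (hydro j i)) ->
  hyd0 (h i j) k - hyd0 (h i k) j + hyd0 (h j k) i - d (hyd1 (h j k) i)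
    + d (d (hyd2 (h j k) i)) = 0 ->
  hyd0 (g i j) k - hyd1 (h i k) j - hyd1 (h j k) i + d (hyd2 (h j k) i) *+ 2 = 0 ->
  hyd1 (h i j) k - hyd0 (g i k) j - hyd1 (h j k) i + d (hyd2 (h j k) i) *+ 2
    + hyd0 (g j k) i - d (hyd1 (g j k) i) = 0 ->
  hyd2 (h j k) i = hyd2 (h i k) j ->
  hyd2 (h i j) k + hyd2 (h j k) i = hyd1 (g j k) i ->
  hyd1 (g i j) k - hyd1 (g i k) j + hyd2 (h j k) i *+ 2 - hyd1 (g j k) i = 0 ->
  jacobiator d pd hydro (x (i, 0%N)) (x (j, 0%N)) (x (k, 0%N)) = 0.
Proof.
move=> h2 g1 skew E00 E10 E01 E20 E02 E11.
rewrite (jacobiatorE dfV skew) !br3_hydro //.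
rewrite !(cyc3D, cyc3MX, cyc3MY) !cyc3C.
rewrite (dxN (dx d)).
rewrite !(rmorphD swapXY) !(rmorphM swapXY) /= !(rmorphD swapXY) !(rmorphM swapXY) /=.
rewrite swapXY_X swapXY_Y !swapXY_polyC !map_polyC /=.
(* d/dx of f(x) delta(x - y) delta(x - z) differentiates f and both deltas *)
have dx3C f : dx (dx d) f%:P%:P = (d f)%:P%:P + f%:P%:P * 'Y + f%:P%:P * 'X.
  by rewrite dxC /= dxC polyCD polyCM.
have dx3D := dxD (dx d); rewrite /= in dx3D.
have dx3MX := dxMX (dx d); rewrite /= in dx3MX.
rewrite !dx3C !dx3D !dx3MX !dx3MY !dx3C.
set a := hyd0 (h i j) k in E00 *; set b := hyd0 (h i k) j in E00 *.
set c := hyd0 (h j k) i in E00 *.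
set a1 := hyd1 (h i j) k in E01 *; set b1 := hyd1 (h i k) j in E10 *.
set c1 := hyd1 (h j k) i in E00 E10 E01 *.
set a2 := hyd2 (h i j) k in E02 *; set b2 := hyd2 (h i k) j in E20 *.
set c2 := hyd2 (h j k) i in E00 E10 E01 E20 E02 E11 *.
set p0 := hyd0 (g i j) k in E10 *; set q0 := hyd0 (g i k) j in E01 *.
set r0 := hyd0 (g j k) i in E01 *.
set p1 := hyd1 (g i j) k in E11 *; set q1 := hyd1 (g i k) j in E11 *.
set r1 := hyd1 (g j k) i in E01 E02 E11 *.
rewrite /= in E00 E10 E01 E20 E02 E11 *.
(* collecting the coefficients of the six monomials in 'X and 'Y *)
transitivity ((a - b + c - d c1 + d (d c2))%:P%:P
  + (p0 - b1 - c1 + d c2 *+ 2)%:P%:P * 'X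
  + (a1 - q0 - c1 + d c2 *+ 2 + r0 - d r1)%:P%:P * 'Y
  + (c2 - b2)%:P%:P * 'X * 'X + (a2 + c2 - r1)%:P%:P * 'Y * 'Y
  + (p1 - q1 + c2 *+ 2 - r1)%:P%:P * 'X * 'Y).
  rewrite !(polyCD, polyCN, polyCMn); ring.
by rewrite E00 E10 E01 E02 E11 E20 !subrr !polyC0 !mul0r !addr0.
Qed.
End Hydrodynamic.

(** * The Jacobi identity of the given bracket on the fields *)

Lemma eq_field3E (s t : field3) :
  (s == t) = match s, t with
             | Tau, Tau | Z1, Z1 | Z2, Z2 => true
             | _, _ => false
             end.
Proof. by case: s t => -[]; apply/eqP. Qed.

Lemma sum_field3 (M : nmodType) (F : field3 -> M) :
  \sum_s F s = F Tau + (F Z1 + F Z2).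
Proof.
rewrite (bigD1 Tau) // (bigD1 Z1) ?eq_field3E //= (bigD1 Z2) ?eq_field3E //=.
by rewrite big1 ?addr0 // => -[]; rewrite ?eq_field3E.
Qed.

(** The generators of the ring in which the six coefficients live, with K for
    2 pi i, k for 1 / K and h1, h2, h3 for g1, g2 / 12, g3 / 2.  With this
    scaling all the coefficients of the bracket and of the differential
    equations are integers, up to k.  A concrete syntax is used so that the
    derivatives in the Jacobi identity are computed by evaluation. *)
Inductive expr :=
  | EK | Ek | Eh1 | Eh2 | Eh3 | Ex of field3 & nat
  | E0 | E1 | EAdd of expr & expr | EOpp of expr | EMul of expr & expr
  | EMn of expr & nat.

(** Simplifying constructors keep the derivatives small: most partial
    derivatives of a given coefficient are zero. *)
Definition sadd e f :=
  match e, f with E0, _ => f | _, E0 => e | _, _ => EAdd e f end.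
Definition smul e f :=
  match e, f with E0, _ | _, E0 => E0 | E1, _ => f | _, E1 => e | _, _ => EMul e f end.
Definition sopp e := if e is E0 then E0 else EOpp e.
Definition smn e n := if e is E0 then E0 else EMn e n.

(** A comparison that reduces on constructors, unlike the one that [field3]
    inherits from the finite ordinals. *)
Definition same_field (s t : field3) : bool :=
  match s, t with
  | Tau, Tau | Z1, Z1 | Z2, Z2 => true
  | _, _ => false
  end.

Declare Scope expr_scope.
Delimit Scope expr_scope with X.
Bind Scope expr_scope with expr.

Section SymbolicGenerators.
Local Notation "e + f" := (EAdd e f) : expr_scope.
Local Notation "e * f" := (EMul e f) : expr_scope.
Local Notation "- e" := (EOpp e) : expr_scope.
Local Notation "e - f" := (EAdd e (EOpp f)) : expr_scope.
Local Notation "e *+ n" := (EMn e n) : expr_scope.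

Definition sym_dh1 := (Ek * (Eh2 - Eh1 * Eh1))%X.
Definition sym_dh2 := (Ek * (Eh3 - Eh1 * Eh2 *+ 4))%X.
Definition sym_dh3 := (Ek * (Eh2 * Eh2 *+ 24 - Eh1 * Eh3 *+ 6))%X.

(** The derivation with values [v] on the coordinates, and with value [dh] on
    tau, which determines it on h1, h2, h3 by the chain rule. *)
Fixpoint expr_deriv (v : field3 * nat -> expr) (dh : expr) (e : expr) : expr :=
  match e with
  | Eh1 => smul dh sym_dh1 | Eh2 => smul dh sym_dh2 | Eh3 => smul dh sym_dh3
  | Ex s n => v (s, n)
  | EAdd e f => sadd (expr_deriv v dh e) (expr_deriv v dh f)
  | EOpp e => sopp (expr_deriv v dh e)
  | EMul e f => sadd (smul (expr_deriv v dh e) f) (smul e (expr_deriv v dh f))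
  | EMn e n => smn (expr_deriv v dh e) n
  | _ => E0
  end.

Definition sym_d := expr_deriv (fun a => Ex a.1 a.2.+1) (Ex Tau 1).
Definition sym_pd (a : field3 * nat) :=
  expr_deriv (fun b => if same_field a.1 b.1 && eqn a.2 b.2 then E1 else E0)
        (if same_field a.1 Tau && eqn a.2 0 then E1 else E0).

Local Notation z1 := (Ex Z1 0).
Local Notation z2 := (Ex Z2 0).
Local Notation z1' := (Ex Z1 1).
Local Notation z2' := (Ex Z2 1).
Local Notation t' := (Ex Tau 1).

Definition sym_g (i j : field3) : expr :=
  match i, j with
  | Tau, Tau => E0
  | Tau, Z1 | Z1, Tau => EK * z1
  | Tau, Z2 | Z2, Tau => EK * z2
  | Z1, Z1 => Eh3 * z2 * z2 - Eh2 * z1 * z2 *+ 2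
  | Z1, Z2 | Z2, Z1 => Eh1 * z1 * z2 *+ 2 - Eh2 * z2 * z2 *+ 4
  | Z2, Z2 => Eh1 * z2 * z2 *+ 4 - z1 * z2 *+ 2
  end%X.

(** The coefficients of delta; those at (Z1, Tau), (Z2, Tau) and (Z2, Z1) are
    read off from anticommutativity, h i j + h j i = d (g i j). *)
Definition sym_h (i j : field3) : expr :=
  match i, j with
  | Tau, Tau => E0
  | Tau, Z1 => EK * z1'
  | Tau, Z2 => EK * z2'
  | Z1, Tau | Z2, Tau => E0
  | Z1, Z1 => - (Eh2 * z2 * z1') + (Eh3 * z2 - Eh2 * z1) * z2'
     + Ek * t' * ((Eh2 * Eh2 *+ 12 - Eh1 * Eh3 *+ 3) * z2 * z2
                 - (Eh3 - Eh1 * Eh2 *+ 4) * z1 * z2)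
  | Z1, Z2 => Eh1 * z2 * z1' + (Eh1 * z1 - Eh2 * z2 *+ 4) * z2'
     + Ek * t' * (Eh1 * Eh2 *+ 4 - Eh3) * z2 * z2
  | Z2, Z1 => Eh1 * z2 * z1' + (Eh1 * z1 - Eh2 * z2 *+ 4) * z2'
     + Ek * t' * ((Eh2 - Eh1 * Eh1) * z1 * z2 *+ 2
                  + (Eh1 * Eh2 *+ 12 - Eh3 *+ 3) * z2 * z2)
  | Z2, Z2 => (Eh1 * z2 *+ 4 - z1) * z2' - z2 * z1'
     + Ek * t' * (Eh2 - Eh1 * Eh1) * z2 * z2 *+ 2
  end%X.

Definition sym_sum (F : field3 -> expr) := sadd (F Tau) (sadd (F Z1) (F Z2)).
Definition sym_hyd0 c k :=
  sym_sum (fun s => sadd (smul (sym_pd (s, 0%N) c) (sym_h s k))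
                      (smul (sym_pd (s, 1%N) c) (sym_d (sym_h s k)))).
Definition sym_hyd1 c k :=
  sym_sum (fun s => sadd (smul (sym_pd (s, 0%N) c) (sym_g s k))
                      (smul (sym_pd (s, 1%N) c) (sadd (sym_d (sym_g s k)) (sym_h s k)))).
Definition sym_hyd2 c k := sym_sum (fun s => smul (sym_pd (s, 1%N) c) (sym_g s k)).
End SymbolicGenerators.

Section Generators.
Local Opaque dx flip aty dy.
Variables (V : comNzRingType) (d : {additive V -> V}).
Variables (pd : field3 * nat -> {additive V -> V}) (x : field3 * nat -> V).
Hypothesis dfV : differential_functions d pd x.
Let dM := df_dM dfV.
Variables (K k h1 h2 h3 : V).

Fixpoint eval (e : expr) : V :=
  match e with
  | EK => K | Ek => k | Eh1 => h1 | Eh2 => h2 | Eh3 => h3 | Ex s n => x (s, n)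
  | E0 => 0 | E1 => 1
  | EAdd e f => eval e + eval f | EOpp e => - eval e | EMul e f => eval e * eval f
  | EMn e n => eval e *+ n
  end.

Hypothesis Kk : K * k = 1.
Hypothesis dK : d K = 0.
Hypothesis dk : d k = 0.
Hypothesis pdK : forall a, pd a K = 0.
Hypothesis pdk : forall a, pd a k = 0.
Hypothesis dH : forall D, (D = d \/ exists a, D = pd a) ->
  [/\ D h1 = D (x (Tau, 0%N)) * (k * (h2 - h1 * h1)),
      D h2 = D (x (Tau, 0%N)) * (k * (h3 - h1 * h2 *+ 4)) &
      D h3 = D (x (Tau, 0%N)) * (k * (h2 * h2 *+ 24 - h1 * h3 *+ 6))].

Lemma eval_sadd e f : eval (sadd e f) = eval e + eval f.
Proof.
by case: e f => [||||| ? ? |||? ?|?|? ?|? ?] -[||||| ? ? |||? ?|?|? ?|? ?] /=;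
  rewrite ?add0r ?addr0.
Qed.
Lemma eval_smul e f : eval (smul e f) = eval e * eval f.
Proof.
by case: e f => [||||| ? ? |||? ?|?|? ?|? ?] -[||||| ? ? |||? ?|?|? ?|? ?] /=;
  rewrite ?mul0r ?mulr0 ?mul1r ?mulr1.
Qed.
Lemma eval_sopp e : eval (sopp e) = - eval e.
Proof. by case: e => *; rewrite /= ?oppr0. Qed.
Lemma eval_smn e n : eval (smn e n) = eval e *+ n.
Proof. by case: e => *; rewrite /= ?mul0rn. Qed.

Lemma eval_expr_deriv (D : {additive V -> V}) v dh :
  (D = d \/ exists a, D = pd a) ->
  (forall f g, D (f * g) = D f * g + f * D g) -> D K = 0 -> D k = 0 ->
  (forall a, eval (v a) = D (x a)) -> eval dh = D (x (Tau, 0%N)) ->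
  forall e, eval (expr_deriv v dh e) = D (eval e).
Proof.
move=> /dH[D1 D2 D3] DM DK Dk Dx Dt.
elim=> [||||| s n |||e IHe f IHf|e IHe|e IHe f IHf|e IHe n] /=;
  rewrite ?(eval_sadd, eval_smul, eval_sopp, eval_smn) /= ?IHe ?IHf
          ?DM ?DK ?Dk ?Dx ?Dt ?D1 ?D2 ?D3 ?raddf0 ?raddfD ?raddfN ?raddfMn //.
by apply: (addrI (D 1)); rewrite addr0 -{1}[1]mulr1 DM mulr1 mul1r.
Qed.

Lemma eval_sym_d e : eval (sym_d e) = d (eval e).
Proof.
apply: eval_expr_deriv => //; [by left|by case=> s n; rewrite (df_dx dfV)|].
by rewrite (df_dx dfV).
Qed.

Lemma eval_sym_pd a e : eval (sym_pd a e) = pd a (eval e).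
Proof.
have pdx s n : eval (if same_field a.1 s && eqn a.2 n then E1 else E0) = pd a (x (s, n)).
  rewrite (df_x dfV); case: a => s' n'; rewrite xpair_eqE eq_field3E -[eqn _ _]/(n' == n) /=.
  by rewrite -/(same_field s' s); case: ifP.
apply: eval_expr_deriv => //; [by right; exists a|exact: df_pdM dfV a|by case].
Qed.

Lemma eval_sym_sum F : eval (sym_sum F) = \sum_s eval (F s).
Proof. by rewrite sum_field3 /sym_sum !eval_sadd. Qed.

Local Notation g := (fun i j => eval (sym_g i j)).
Local Notation h := (fun i j => eval (sym_h i j)).

Lemma eval_hyd0 c l : eval (sym_hyd0 c l) = hyd0 d pd h (eval c) l.
Proof.
rewrite eval_sym_sum; apply: eq_bigr => s _.
by rewrite eval_sadd !eval_smul !eval_sym_pd eval_sym_d.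
Qed.
Lemma eval_hyd1 c l : eval (sym_hyd1 c l) = hyd1 d pd g h (eval c) l.
Proof.
rewrite eval_sym_sum; apply: eq_bigr => s _.
by rewrite eval_sadd !eval_smul !eval_sym_pd eval_sadd eval_sym_d.
Qed.
Lemma eval_hyd2 c l : eval (sym_hyd2 c l) = hyd2 pd g (eval c) l.
Proof.
rewrite eval_sym_sum; apply: eq_bigr => s _.
by rewrite eval_smul eval_sym_pd.
Qed.

Lemma gen_gC i j : eval (sym_g i j) = eval (sym_g j i).
Proof. by case: i j => -[]. Qed.

Lemma gen_hD i j : eval (sym_h i j) + eval (sym_h j i) = d (eval (sym_g i j)).
Proof. by rewrite -eval_sym_d; case: i j => -[] /=; ring. Qed.

Lemma gen_h_order i j s n : pd (s, n.+2) (eval (sym_h i j)) = 0.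
Proof. by rewrite -eval_sym_pd; case: i j s => -[] -[] /=. Qed.

Lemma gen_g_order i j s n : pd (s, n.+1) (eval (sym_g i j)) = 0.
Proof. by rewrite -eval_sym_pd; case: i j s => -[] -[] /=. Qed.

Lemma gen_skew i j : hydro g h i j = - flip d (hydro g h j i).
Proof. by apply: hydro_skew; [exact: gen_gC|exact: gen_hD]. Qed.

Lemma gen_TauE a : a != Tau -> hydro g h Tau a = aty d (K * x (a, 0%N)) 'X.
Proof.
move=> aT; have -> : 'X = 1%:P * 'X :> {poly V} by rewrite mul1r.
rewrite atyMX !atyC !mul1r dM dK mul0r add0r (df_dx dfV) /hydro addrC mul_polyC.
by case: a aT => [/eqP||].
Qed.

Lemma gen_Tau0 : hydro g h Tau Tau = 0.
Proof. by rewrite /hydro /= scale0r addr0. Qed.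

(** Each of the six coefficients, at each of the 27 triples of fields, is a
    polynomial identity modulo K k = 1 once the derivatives are computed. *)
Lemma gen_jacobi i j l :
  jacobiator d pd (hydro g h) (x (i, 0%N)) (x (j, 0%N)) (x (l, 0%N)) = 0.
Proof.
apply: (jacobiator_hydro dfV gen_h_order gen_g_order gen_skew).
all: rewrite -?(eval_hyd0, eval_hyd1, eval_hyd2) -?eval_sym_d.
all: case: i j l => -[] -[] /=; ring: Kk.
Qed.
End Generators.

(** * The ratio of the two fields *)

Section Quotient.
Variables (I : finType) (V : comNzRingType) (d : {additive V -> V}).
Variables (pd : I * nat -> {additive V -> V}) (x : I * nat -> V).
Hypothesis dfV : differential_functions d pd x.
Variables (P : I -> I -> {poly V}) (y z zi : V).
Hypothesis zK : z * zi = 1.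

Lemma br_1l E : br d pd P 1 E = 0.
Proof.
apply: (addrI (br d pd P 1 E)); rewrite addr0 -{3}[1]mulr1 (brMl dfV) !scale1r //.
Qed.

Lemma br_1r E : br d pd P E 1 = 0.
Proof.
apply: (addrI (br d pd P E 1)); rewrite addr0 -{3}[1]mulr1 (brMr dfV).
by rewrite !aty1 ?(derivation1 dfV).
Qed.

(** The inverse of z is handled by applying the Leibniz rule to z zi = 1. *)
Lemma br_divl E : br d pd P (y * zi) E =
  zi *: br d pd P y E - (y * zi * zi) *: br d pd P z E.
Proof.
(* {1, E} = 0 gives z {zi, E} = - zi {z, E}; multiply by zi *)
have brzi : br d pd P zi E = - (zi * zi *: br d pd P z E).
  have : zi *: br d pd P (z * zi) E = 0 by rewrite zK br_1l scaler0.
  rewrite (brMl dfV) scalerDr !scalerA [zi * z]mulrC zK scale1r => /eqP.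
  by rewrite addr_eq0 => /eqP.
by rewrite (brMl dfV) brzi scalerN scalerA mulrA addrC.
Qed.

Lemma br_divr E : br d pd P E (y * zi) =
  aty d zi (br d pd P E y) - aty d (y * zi * zi) (br d pd P E z).
Proof.
have dM := df_dM dfV.
have brzi : br d pd P E zi = - aty d (zi * zi) (br d pd P E z).
  have : aty d zi (br d pd P E (z * zi)) = 0 by rewrite zK br_1r aty0r.
  rewrite (brMr dfV) atyDr -!atyM // [zi * z]mulrC zK aty1 ?(derivation1 dfV) // => /eqP.
  by rewrite addr_eq0 => /eqP.
by rewrite (brMr dfV) brzi atyNr -atyM // mulrA addrC.
Qed.
End Quotient.

Section Ratio.
Local Opaque dx flip aty dy.
Variables (V : comNzRingType) (d : {additive V -> V}).
Variables (pd : field3 * nat -> {additive V -> V}) (x : field3 * nat -> V).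
Hypothesis dfV : differential_functions d pd x.
Let dM := df_dM dfV.
Variables (K k h1 h2 h3 : V).
Hypothesis dK : d K = 0.
Hypothesis dk : d k = 0.
Hypothesis dH : forall D : {additive V -> V}, (D = d \/ exists a, D = pd a) ->
  [/\ D h1 = D (x (Tau, 0%N)) * (k * (h2 - h1 * h1)),
      D h2 = D (x (Tau, 0%N)) * (k * (h3 - h1 * h2 *+ 4)) &
      D h3 = D (x (Tau, 0%N)) * (k * (h2 * h2 *+ 24 - h1 * h3 *+ 6))].
Local Notation ev := (eval x K k h1 h2 h3).
Local Notation P := (hydro (fun i j => ev (sym_g i j)) (fun i j => ev (sym_h i j))).
Variable zi : V.
Local Notation z1 := (x (Z1, 0%N)).
Local Notation z2 := (x (Z2, 0%N)).
Hypothesis zK : z2 * zi = 1.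
Local Notation p := (z1 * zi).

(** {tau, z_a} is proportional to z_a with a factor that does not depend on a,
    so that tau commutes with the ratio. *)
Lemma br_tau_ratio : br d pd P (x (Tau, 0%N)) p = 0.
Proof.
rewrite (br_divr dfV _ _ zK) !(br_x dfV) !(gen_TauE dfV) ?eq_field3E //.
rewrite -!atyM // (_ : p * zi * (K * z2) = zi * (K * z1)) ?subrr //.
by ring: zK.
Qed.

Lemma aty_hydro f (g h : field3 -> field3 -> V) i j :
  aty d f (hydro g h i j) = (f * h i j + g i j * d f)%:P + (f * g i j) *: 'X.
Proof. by rewrite /hydro -!mul_polyC atyDr atyMX !atyC; ring. Qed.

(** The polynomial - (4 p^3 - g2 p - g3) / 2 in terms of h2 and h3. *)
Definition ratio_metric : V := h3 + h2 * p *+ 6 - p * p * p *+ 2.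

(** The quotient rule gives the coefficient of delta'.  The coefficient c of
    delta needs no computation: comparing the coefficients of delta in
    {p, p} = - flip {p, p} yields c = g' - c. *)
Lemma br_ratio : exists2 c, br d pd P p p = c%:P + ratio_metric *: 'X
  & c + c = d ratio_metric.
Proof.
have [c E] : exists c, br d pd P p p = c%:P + ratio_metric *: 'X.
  have row a : br d pd P (x (a, 0%N)) p =
     aty d zi (P a Z1) - aty d (p * zi) (P a Z2).
    by rewrite (br_divr dfV _ _ zK) !(br_x dfV).
  rewrite (br_divl dfV _ _ zK) !row !aty_hydro.
  have combine (u v a b a' b' e f e' f' : V) :
      u *: (a%:P + b *: 'X - (a'%:P + b' *: 'X)) - v *: (e%:P + f *: 'X - (e'%:P + f' *: 'X))
      = (u * (a - a') - v * (e - e'))%:P + (u * (b - b') - v * (f - f')) *: 'X.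
    by rewrite -!mul_polyC; ring.
  rewrite combine; eexists; congr (_ + _ *: _).
  by rewrite /ratio_metric /=; ring: zK.
exists c => //.
have skew i j : P i j = - flip d (P j i) by exact: (gen_skew dfV dK dk dH).
(* the coefficient of delta in {p, p} = - flip {p, p} *)
have := br_anticomm dfV skew p p; rewrite E -mul_polyC flipD flipC flipMX flipC dxC.
move=> /(congr1 (fun F : {poly V} => F`_0)).
rewrite coefN !coefD coefN coefD !coefC !coefMX /= !addr0 opprB => H.
by rewrite {1}H subrK.
Qed.

(** All the terms in which h2 and h3 are differentiated carry a factor tau'. *)
Lemma d_ratio_metric : exists q,
  d ratio_metric = x (Tau, 1%N) * q + (h2 *+ 6 - p * p *+ 6) * d p.
Proof.
have [_ d2 d3] := dH (or_introl erefl).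
exists (k * (h2 * h2 *+ 24 - h1 * h3 *+ 6) + k * (h3 - h1 * h2 *+ 4) * p *+ 6).
rewrite /ratio_metric raddfB raddfD !raddfMn /= !(dM (_ * _)) (dM h2) dM d2 d3.
rewrite (df_dx dfV); ring.
Qed.
End Ratio.

(** * Partial derivatives on the jet space *)

Section Jets.
Variables (I : finType) (C : numClosedFieldType).
Local Notation jet := (jet I C).
Implicit Types (D : set jet) (F G : jet -> C) (u v : jet) (a b : I * nat).

Lemma coord_continuous a : continuous (fun u : jet => u a).
Proof. exact: (@proj_continuous _ (fun=> C) a). Qed.

(** The topology of the jet space is the product topology, in which a change
    of one coordinate is continuous. *)
Lemma set_jetE u a w : set_jet u a w = dfwith (u : forall b, C) a w.
Proof.
apply/funext => b; rewrite /set_jet; case: eqP => [->|/eqP ba]; first by rewrite dfwithin.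
by rewrite dfwithout // eq_sym.
Qed.

Lemma set_jet_continuous u a : continuous (set_jet u a : C -> jet).
Proof.
have -> : set_jet u a = (fun w : C => dfwith (u : forall b, C) a w).
  by apply/funext => w; exact: set_jetE.
exact: (@dfwith_continuous _ (fun=> C) u a).
Qed.

Lemma set_jet_id u a : set_jet u a (u a) = u.
Proof. by apply/funext => b; rewrite /set_jet; case: eqP => [->|]. Qed.

Lemma set_jet_same u a w : set_jet u a w a = w.
Proof. by rewrite /set_jet eqxx. Qed.

Lemma set_jet_set u a w w' : set_jet (set_jet u a w) a w' = set_jet u a w'.
Proof. by apply/funext => b; rewrite /set_jet; case: eqP. Qed.

Lemma set_jet_swap u a b w w' : a != b ->
  set_jet (set_jet u a w) b w' = set_jet (set_jet u b w') a w.
Proof.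
move=> ab; apply/funext => c; rewrite /set_jet.
by case: (eqVneq c b) => [->|//]; rewrite eq_sym (negPf ab).
Qed.

Lemma cvg_jet (T : Type) (F : set_system T) (FF : Filter F) (G : T -> jet) v :
  (forall a, (fun z => G z a) @ F --> v a) -> G @ F --> v.
Proof.
move=> cvG; apply/cvg_sup => a; apply/cvg_image.
  rewrite eqEsubset; split => // w _; exists (set_jet v a w) => //.
move=> Q /(cvG a) /= FQ.
exists ((fun u : jet => u a) @^-1` Q) => //.
rewrite eqEsubset; split=> [w [u /= Qu <-] //|w Qw].
by exists (set_jet v a w) => /=; rewrite ?/proj set_jet_same.
Qed.

Lemma near_set_jet D u a : open D -> D u -> \forall w \near u a, D (set_jet u a w).
Proof.
move=> oD Du; apply: (set_jet_continuous (u := u) (a := a) (x := u a)).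
by rewrite set_jet_id; apply: open_nbhs_nbhs.
Qed.

Definition pderivable a F u := derivable (fun w : C => F (set_jet u a w)) (u a) 1.

Lemma pderE a F u : pder a F u = 'D_1 (fun w : C => F (set_jet u a w)) (u a).
Proof. by rewrite /pder derive1E. Qed.

Lemma eq_on_pder D a F G : open D -> (forall u, D u -> F u = G u) ->
  forall u, D u -> pder a F u = pder a G u.
Proof.
move=> oD FG u Du; rewrite !pderE; apply: near_eq_derive.
by apply: filterS (near_set_jet a oD Du) => w /FG.
Qed.

Lemma eq_on_pderivable D a F G : open D -> (forall u, D u -> F u = G u) ->
  forall u, D u -> pderivable a F u -> pderivable a G u.
Proof.
move=> oD FG u Du; apply: near_eq_derivable.
by apply: filterS (near_set_jet a oD Du) => w /FG.
Qed.

Lemma eq_on_continuous D F G : open D -> (forall u, D u -> F u = G u) ->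
  forall u, D u -> {for u, continuous F} -> {for u, continuous G}.
Proof.
move=> oD FG u Du cF; have GF : {near u, F =1 G}.
  by apply: filterS (open_nbhs_nbhs (conj oD Du)) => v /FG.
change (G @ u --> G u); rewrite -(FG u Du).
exact: (cvg_trans (near_eq_cvg GF) cF).
Qed.

Lemma pderD a F G u : pderivable a F u -> pderivable a G u ->
  pderivable a (F + G) u /\ pder a (F + G) u = pder a F u + pder a G u.
Proof.
by move=> dF dG; rewrite !pderE; split; [exact: derivableD dF dG|exact: deriveD dF dG].
Qed.

Lemma pderN a F u : pderivable a F u ->
  pderivable a (- F) u /\ pder a (- F) u = - pder a F u.
Proof.
by move=> dF; rewrite !pderE; split; [exact: derivableN dF|exact: deriveN dF].
Qed.

Lemma pderM a F G u : pderivable a F u -> pderivable a G u ->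
  pderivable a (F * G) u /\ pder a (F * G) u = pder a F u * G u + F u * pder a G u.
Proof.
move=> dF dG; rewrite !pderE; split; first exact: derivableM dF dG.
rewrite [LHS](deriveM dF dG) set_jet_id addrC; congr (_ + _).
by rewrite mulrC.
Qed.

Lemma pderV a F u : F u != 0 -> pderivable a F u ->
  pderivable a (fun v => (F v)^-1) u /\
  pder a (fun v => (F v)^-1) u = - ((F u)^-1 * (F u)^-1) * pder a F u.
Proof.
move=> F0 dF; rewrite !pderE; split.
  by apply: derivableV dF; rewrite set_jet_id.
rewrite [LHS](deriveV _ dF) set_jet_id //.
by rewrite -[X in _ = - X * _]invfM.
Qed.

Lemma pder_cst a (c : C) u : pderivable a (cst c) u /\ pder a (cst c) u = 0.
Proof. by rewrite pderE; split; [exact: derivable_cst|exact: derive_cst]. Qed.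

Lemma pder_fld a i n u : pderivable a (fld i n : jet -> C) u /\
  pder a (fld i n) u = (a == (i, n))%:R.
Proof.
rewrite pderE /pderivable /fld /set_jet eq_sym; case: eqP => _; split.
- exact: derivable_id.
- exact: derive_id.
- exact: derivable_cst.
- exact: derive_cst.
Qed.

Lemma pder_comp a (g : C -> C) i n u : derivable g (u (i, n)) 1 ->
  pderivable a (fun v => g (v (i, n))) u /\
  pder a (fun v => g (v (i, n))) u = (a == (i, n))%:R * derive1 g (u (i, n)).
Proof.
move=> dg; rewrite pderE /pderivable /set_jet eq_sym; case: (eqVneq (i, n) a) => [<-|_].
  by rewrite mul1r derive1E.
by rewrite mul0r; split; [exact: derivable_cst|exact: derive_cst].
Qed.
End Jets.

(** * Operations preserving regularity *)

Section FiniteOrder.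
Variables (I : finType) (C : numClosedFieldType).
Local Notation jet := (jet I C).
Local Notation fct := (jet -> C).
Implicit Types (D : set jet) (F G : fct) (u v : jet) (a b : I * nat).

Lemma finite_order_cst (c : C) : finite_order (cst c : fct).
Proof. by exists 0%N. Qed.

Lemma finite_order_coord (g : C -> C) i n : finite_order ((fun u => g (u (i, n))) : fct).
Proof. by exists n.+1 => u v uv; rewrite uv /=. Qed.

Lemma finite_order_map2 (op : C -> C -> C) F G : finite_order F -> finite_order G ->
  finite_order (fun u => op (F u) (G u)).
Proof.
move=> [N hN] [M hM]; exists (maxn N M) => u v uv.
rewrite (hN u v) ?(hM u v) // => a le; apply: uv; rewrite leq_max le ?orbT //.
Qed.

Lemma pder_high F N : (forall u v, (forall a, (a.2 < N)%N -> u a = v a) -> F u = F v) ->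
  forall a, (N <= a.2)%N -> pder a F = 0.
Proof.
move=> hN a le; apply/funext => u.
rewrite /pder (_ : (fun w : C => F (set_jet u a w)) = cst (F u)); first exact: derive1_cst.
apply/funext => w; apply: hN => b lt; rewrite /set_jet; case: eqP => // ba.
by rewrite ba ltnNge le in lt.
Qed.

Lemma finite_order_pder F a : finite_order F -> finite_order (pder a F).
Proof.
move=> [N hN]; exists N => u v uv.
have [lt|le] := ltnP a.2 N; last by rewrite (pder_high hN).
rewrite /pder (uv a lt); congr derive1; apply/funext => w; apply: hN => b lt'.
by rewrite /set_jet; case: eqP => // _; exact: uv.
Qed.

Lemma Dtot_sum F N : (forall u v, (forall a, (a.2 < N)%N -> u a = v a) -> F u = F v) ->
  Dtot F = \sum_i \sum_(n < N) (fld i n.+1 : fct) * pder (i, val n) F.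
Proof.
move=> hN; apply/funext => u.
rewrite /Dtot (@fsum_jets _ _ _ N) => [|a le]; last by rewrite (pder_high hN) // mulr0.
rewrite fct_sumE; apply: eq_bigr => i _.
by rewrite fct_sumE; apply: eq_bigr => n _.
Qed.

Definition smooth D F := forall (s : seq (I * nat)) u, D u ->
  {for u, continuous (pders s F)} /\ forall a, pderivable a (pders s F) u.

Lemma smooth_pder D a F : smooth D F -> smooth D (pder a F).
Proof.
move=> sF s u Du.
have <- : pders (rcons s a) F = pders s (pder a F).
  by rewrite /pders -cats1 foldr_cat.
exact: sF.
Qed.

(** Ring expressions in the functions of B. *)
Inductive algebraic (B : set fct) : set fct :=
  | alg_base F of B F : algebraic B F
  | alg_cst c : algebraic B (cst c)
  | alg_add F G of algebraic B F & algebraic B G : algebraic B (F + G)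
  | alg_opp F of algebraic B F : algebraic B (- F)
  | alg_mul F G of algebraic B F & algebraic B G : algebraic B (F * G).

(** If the partial derivatives of the functions of B are again ring expressions
    in B, so are all iterated ones, and they inherit continuity and
    differentiability from B. *)
Lemma smooth_algebraic D B : open D ->
  (forall F, B F -> forall u, D u ->
     {for u, continuous F} /\ forall a, pderivable a F u) ->
  (forall F, B F -> forall a, exists2 G, algebraic B G & forall u, D u -> pder a F u = G u) ->
  forall F, algebraic B F -> smooth D F.
Proof.
move=> oD B1 B2.
have A1 F : algebraic B F -> forall u, D u ->
     {for u, continuous F} /\ forall a, pderivable a F u.
  elim=> {F} [F /B1//|c u Du|F G _ IF _ IG u Du|F _ IF u Du|F G _ IF _ IG u Du].
  - by split=> [|a]; [exact: cst_continuous|exact: (pder_cst _ _ _).1].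
  - have [[cF dF] [cG dG]] := (IF u Du, IG u Du).
    by split=> [|a]; [exact: continuousD cF cG|exact: (pderD (dF a) (dG a)).1].
  - have [cF dF] := IF u Du.
    by split=> [|a]; [exact: continuousN cF|exact: (pderN (dF a)).1].
  - have [[cF dF] [cG dG]] := (IF u Du, IG u Du).
    by split=> [|a]; [exact: continuousM cF cG|exact: (pderM (dF a) (dG a)).1].
have A2 F : algebraic B F -> forall a, exists2 G, algebraic B G & forall u, D u -> pder a F u = G u.
  elim=> {F} [F /B2//|c a|F G AF IF AG IG a|F AF IF a|F G AF IF AG IG a].
  - by exists (cst 0) => [|u _]; [exact: alg_cst|rewrite (pder_cst _ _ _).2].
  - have [[F' AF' F'E] [G' AG' G'E]] := (IF a, IG a).
    exists (F' + G') => [|u Du]; first exact: alg_add.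
    have [[_ dF] [_ dG]] := (A1 _ AF u Du, A1 _ AG u Du).
    by rewrite (pderD (dF a) (dG a)).2 F'E // G'E.
  - have [F' AF' F'E] := IF a.
    exists (- F') => [|u Du]; first exact: alg_opp.
    have [_ dF] := A1 _ AF u Du.
    by rewrite (pderN (dF a)).2 F'E.
  - have [[F' AF' F'E] [G' AG' G'E]] := (IF a, IG a).
    exists (F' * G + F * G') => [|u Du]; first by apply: alg_add; exact: alg_mul.
    have [[_ dF] [_ dG]] := (A1 _ AF u Du, A1 _ AG u Du).
    by rewrite (pderM (dF a) (dG a)).2 F'E // G'E.
move=> F AF s.
have [G AG FG] : exists2 G, algebraic B G & forall u, D u -> pders s F u = G u.
  elim: s => [|a s [G AG FG]]; first by exists F.
  have [G' AG' GG'] := A2 _ AG a; exists G' => // u Du.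
  by rewrite -GG' //; apply: eq_on_pder oD _ _ Du.
move=> u Du; have GF v : D v -> G v = pders s F v by move=> /FG.
have [cG dG] := A1 _ AG u Du; split; first exact: (eq_on_continuous oD GF Du cG).
by move=> a; apply: (eq_on_pderivable oD GF Du (dG a)).
Qed.

Lemma smooth_closed D : open D -> forall F, algebraic (smooth D) F -> smooth D F.
Proof.
move=> oD; apply: smooth_algebraic => // F sF; first by move=> u; exact: (sF [::]).
by move=> a; exists (pder a F) => //; apply: alg_base; exact: smooth_pder.
Qed.

Section Regular.
Variables (D : set jet) (oD : open D).

Lemma regular_cst (c : C) : regular D (cst c).
Proof.
split; first exact: finite_order_cst.
by apply: (smooth_closed oD); exact: alg_cst.
Qed.

Lemma regularD F G : regular D F -> regular D G -> regular D (F + G).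
Proof.
move=> [foF sF] [foG sG]; split; first exact: (finite_order_map2 +%R).
by apply: (smooth_closed oD); apply: alg_add; apply: alg_base.
Qed.

Lemma regularM F G : regular D F -> regular D G -> regular D (F * G).
Proof.
move=> [foF sF] [foG sG]; split; first exact: (finite_order_map2 *%R).
by apply: (smooth_closed oD); apply: alg_mul; apply: alg_base.
Qed.

Lemma regularN F : regular D F -> regular D (- F).
Proof.
move=> rF; have -> : - F = cst (-1) * F.
  by apply/funext => u; rewrite -[RHS]/(-1 * F u) mulN1r.
exact: (regularM (regular_cst (-1)) rF).
Qed.

Lemma regular_sum (J : finType) (F : J -> fct) :
  (forall j, regular D (F j)) -> regular D (\sum_j F j).
Proof.
move=> rF; exact: (big_ind (regular D) (regular_cst 0) regularD).
Qed.

Lemma regular_pder a F : regular D F -> regular D (pder a F).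
Proof. by move=> [foF sF]; split; [exact: finite_order_pder|exact: smooth_pder]. Qed.

Lemma regular_fld i n : regular D (fld i n).
Proof.
split; first exact: (finite_order_coord id).
apply: (@smooth_algebraic _ [set F | F = fld i n]) => //; last exact: alg_base.
- move=> F -> u _; split=> [|a]; first exact: coord_continuous.
  exact: (pder_fld a i n u).1.
- move=> F -> a; exists (cst (a == (i, n))%:R); first exact: alg_cst.
  by move=> u _; rewrite (pder_fld a i n u).2.
Qed.

Lemma regular_Dtot F : regular D F -> regular D (Dtot F).
Proof.
move=> rF; have [[N hN] _] := rF; rewrite (Dtot_sum hN).
apply: regular_sum => i; apply: regular_sum => n; apply: regularM.
  exact: regular_fld.
exact: regular_pder.
Qed.

Lemma regular_pderivable F u a : regular D F -> D u -> pderivable a F u.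
Proof. by move=> [_ sF] Du; have [_] := sF [::] u Du; apply. Qed.

Lemma regular_continuous F u : regular D F -> D u -> {for u, continuous F}.
Proof. by move=> [_ sF] Du; have [] := sF [::] u Du. Qed.

(** The derivative of 1 / F is - (1 / F)^2 dF, so that 1 / F and the smooth
    functions form a family to which [smooth_algebraic] applies. *)
Lemma regularV F : regular D F -> (forall u, D u -> F u != 0) ->
  regular D (fun u => (F u)^-1).
Proof.
move=> rF F0; split; first by apply: (finite_order_map2 (fun x _ => x^-1)) rF.1 rF.1.
pose B := smooth D `|` [set (fun u => (F u)^-1)].
apply: (@smooth_algebraic _ B) => //; last by apply: alg_base; right.
- move=> G [sG u /(sG [::])//|-> u Du]; split=> [|a].
    by apply: continuousV; [exact: F0|exact: regular_continuous].
  by apply: (pderV _ _).1; [exact: F0|exact: regular_pderivable].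
- move=> G [sG a|-> a].
    by exists (pder a G) => //; apply: alg_base; left; exact: smooth_pder.
  exists (- ((fun u => (F u)^-1) * (fun u => (F u)^-1)) * pder a F).
    apply: alg_mul; last by apply: alg_base; left; apply: smooth_pder; case: rF.
    by apply: alg_opp; apply: alg_mul; apply: alg_base; right.
  by move=> u Du; rewrite (pderV (F0 u Du) _).2 //; exact: regular_pderivable.
Qed.

End Regular.
End FiniteOrder.

(** * Symmetry of second complex derivatives *)

(** What is used of the complex numbers over a realType to reduce complex
    derivatives to real ones: an embedding of the reals and a real part.
    [cp_inj] recovers a complex number from the real parts of its multiples. *)
Record complex_plane (R : realType) (C : numClosedFieldType)
    (toC : {rmorphism R -> C}) (reC : C -> R) : Prop := {
  cp_norm : forall x, `|toC x| = toC `|x|;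
  cp_ltr : forall x y, (toC x < toC y) = (x < y);
  cp_pos : forall e, 0 < e -> exists r, toC r = e;
  cp_reB : forall z w, reC (z - w) = reC z - reC w;
  cp_re : forall x z, reC (toC x * z) = x * reC z;
  cp_re_le : forall z, toC `|reC z| <= `|z|;
  cp_inj : forall z w, (forall c, reC (c * z) = reC (c * w)) -> z = w }.

Section RealPart.
Variables (R : realType) (C : numClosedFieldType).
Variables (toC : {rmorphism R -> C}) (reC : C -> R).
Hypothesis CP : complex_plane toC reC.

Let toCD x y : toC (x + y) = toC x + toC y. Proof. exact: rmorphD. Qed.
Let toCB x y : toC (x - y) = toC x - toC y. Proof. exact: rmorphB. Qed.
Let toC0 : toC 0 = 0. Proof. exact: rmorph0. Qed.
Let toCV x : toC x^-1 = (toC x)^-1. Proof. exact: fmorphV. Qed.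
Let toC_eq0 x : (toC x == 0) = (x == 0). Proof. exact: fmorph_eq0. Qed.
Let norm_toC := cp_norm CP.
Let ltr_toC := cp_ltr CP.
Let reCB := cp_reB CP.
Let reC_toC := cp_re CP.
Let norm_reC := cp_re_le CP.

Lemma toC_continuous : continuous toC.
Proof.
move=> x; apply/cvgrPdist_lt => e e0.
have [r re] := cp_pos CP e0; rewrite -{e}re -toC0 ltr_toC in e0 *; move: e0 => r0.
have nb : \forall y \near x, `|x - y| < r by apply/nbhs_ballP; exists r.
by apply: filterS nb => y; rewrite -toCB norm_toC ltr_toC.
Qed.

Lemma reC_continuous : continuous reC.
Proof.
move=> z; apply/(@cvgrPdist_lt _ _ _ _ (nbhs_filter (z : C))) => e e0; apply/nbhs_ballP.
exists (toC e) => [|w zw]; first by rewrite /= -toC0 ltr_toC.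
by rewrite /= -reCB -ltr_toC; apply: le_lt_trans (norm_reC _) zw.
Qed.

Lemma toC_dnbhs : toC @ 0^' --> 0^'.
Proof.
move=> A A0; have nA : nbhs (toC 0) [set z | z != 0 -> A z] by rewrite toC0; exact: A0.
have := toC_continuous nA; apply: (@filterS _ (nbhs (0 : R)) (nbhs_filter (0 : R))).
by move=> x H x0; apply: H; rewrite toC_eq0.
Qed.

(** Along a real line, the real part of a multiple of a complex differentiable
    function has the expected real derivative; this makes the real mean value
    theorem available. *)
Lemma is_derive_re (f : C -> C) (c z : C) (s : R) : derivable f (z + toC s) 1 ->
  is_derive s 1 (fun s => reC (c * f (z + toC s))) (reC (c * 'D_1 f (z + toC s))).
Proof.
move=> df; set w := z + toC s.
have cf : h^-1 *: (f (h *: 1 + w) - f w) @[h --> 0^'] --> 'D_1 f w by exact: df.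
have cr : h^-1 *: (reC (c * f (z + toC (h *: 1 + s))) - reC (c * f w)) @[h --> 0^'] -->
    reC (c * 'D_1 f w).
  have -> : (fun h : R => h^-1 *: (reC (c * f (z + toC (h *: 1 + s))) - reC (c * f w))) =
     (fun y : C => reC (c * y)) \o (fun h : C => h^-1 *: (f (h *: 1 + w) - f w)) \o toC.
    apply/funext => h /=; rewrite -reCB -mulrBr -[LHS]/(h^-1 * _) -reC_toC toCV mulrCA.
    congr (reC (_ * (_ * (f _ - _)))).
    by rewrite -[h *: 1]/(h * 1) -[toC h *: 1]/(toC h * 1) !mulr1 toCD addrCA.
  have c1 := cvg_comp _ _ toC_dnbhs cf.
  have c2 : (fun y : C => reC (c * y)) @ 'D_1 f w --> reC (c * 'D_1 f w).
    apply: (@continuous_comp _ _ _ (fun y : C => c * y) reC); last exact: reC_continuous.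
    exact: mulrl_continuous.
  exact: (cvg_comp _ _ c1 c2).
by apply: DeriveDef; [apply: cvgP cr|exact: cvg_lim cr].
Qed.

Variable I : finType.
Local Notation jet := (jet I C).
Local Notation fct := (jet -> C).
Implicit Types (D : set jet) (F G : fct) (u v : jet) (a b : I * nat).

(** The real plane through u in the directions of the coordinates a and b. *)
Definition plane u a b (s t : R) : jet :=
  set_jet (set_jet u a (u a + toC s)) b (u b + toC t).

Lemma planeC u a b s t : a != b -> plane u a b s t = plane u b a t s.
Proof. exact: set_jet_swap. Qed.

Lemma plane_cvg u a b : a != b ->
  (fun z : R * R => plane u a b z.1 z.2) @ ((0 : R), (0 : R)) --> u.
Proof.
move=> ab; apply: cvg_jet => c /=; rewrite /plane /set_jet.
have shift (v : C) (p : R * R -> R) : continuous p -> p (0, 0) = 0 ->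
    v + toC (p z) @[z --> ((0 : R), (0 : R))] --> v.
  move=> cp p0.
  have H : toC (p z) @[z --> ((0 : R), (0 : R))] --> toC (p (0, 0)).
    exact: (cvg_comp _ _ (cp (0, 0)) (@toC_continuous (p (0, 0)))).
  rewrite p0 toC0 in H; rewrite -[X in _ --> X](addr0 v).
  exact: (cvgD (cvg_cst v) H).
have [->|cb] := eqVneq c b; first by apply: shift => //; by move=> [? ?]; exact: cvg_snd.
have [->|ca] := eqVneq c a; first by apply: shift => //; by move=> [? ?]; exact: cvg_fst.
exact: cvg_cst.
Qed.

Lemma plane_derive F (c : C) u a b (s t : R) : a != b ->
  pderivable a F (plane u a b s t) ->
  is_derive s 1 (fun s => reC (c * F (plane u a b s t)))
    (reC (c * pder a F (plane u a b s t))).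
Proof.
move=> ab dF.
have E w : set_jet (plane u a b s t) a w = set_jet (set_jet u b (u b + toC t)) a w.
  by rewrite planeC // /plane set_jet_set.
have pa : plane u a b s t a = u a + toC s by rewrite planeC // /plane set_jet_same.
pose g w := F (set_jet (plane u a b s t) a w).
have -> : (fun s => reC (c * F (plane u a b s t))) = (fun s => reC (c * g (u a + toC s))).
  by apply/funext => s'; rewrite /g E [plane u a b s' t]planeC.
rewrite pderE pa; apply: (@is_derive_re g).
by rewrite -pa.
Qed.

Lemma dist_le_half (x y z e : R) : `|x - z| < e / 2 -> `|y - z| < e / 2 -> `|x - y| <= e.
Proof. by rewrite (distrC y z) => xz zy; have := ler_distD z x y; lra. Qed.

Lemma mean_value (f df : R -> R) (h : R) : 0 < h ->
  (forall s, 0 <= s <= h -> is_derive s 1 f (df s)) ->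
  exists2 xi, 0 <= xi <= h & f h - f 0 = df xi * h.
Proof.
move=> h0 fd.
have [||xi xiI ->] := @MVT R f df 0 h h0.
- move=> s; rewrite in_itv /= => /andP[s0 sh]; apply: fd; by rewrite !ltW.
- apply: derivable_within_continuous => s; rewrite in_itv /= => /fd H.
  exact: ex_derive.
- exists xi; last by rewrite subr0.
  by move: xiI; rewrite in_itv /= => /andP[/ltW-> /ltW->].
Qed.

(** The mean value theorem in the direction a, then in the direction b.  The
    left-hand side is symmetric in a and b, the right-hand side is not. *)
Lemma second_difference D F (c : C) u a b (h : R) : a != b -> 0 < h -> regular D F ->
  (forall s t, 0 <= s <= h -> 0 <= t <= h -> D (plane u a b s t)) ->
  exists s t, [/\ 0 <= s <= h, 0 <= t <= h &
    (reC (c * F (plane u a b h h)) - reC (c * F (plane u a b h 0)))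
    - (reC (c * F (plane u a b 0 h)) - reC (c * F (plane u a b 0 0)))
    = reC (c * pder b (pder a F) (plane u a b s t)) * h * h].
Proof.
move=> ab h0 rF DP.
have h0h : 0 <= h <= h by rewrite lexx ltW.
have h00 : (0 : R) <= 0 <= h by apply/andP; split; [exact: lexx|exact: ltW].
have ba : b != a by rewrite eq_sym.
have [s hs ->] := @mean_value
  (fun s => reC (c * F (plane u a b s h)) - reC (c * F (plane u a b s 0)))
  (fun s => reC (c * pder a F (plane u a b s h)) - reC (c * pder a F (plane u a b s 0)))
  h h0 (fun s hs => is_deriveB (plane_derive c ab (regular_pderivable rF (DP s h hs h0h)))
    (plane_derive c ab (regular_pderivable rF (DP s 0 hs h00)))).
have rF' := regular_pder a rF.
have [|t ht ->] := @mean_value (fun t => reC (c * pder a F (plane u a b s t)))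
  (fun t => reC (c * pder b (pder a F) (plane u a b s t))) h h0.
  move=> t ht; have := @plane_derive (pder a F) c u b a t s ba.
  rewrite (_ : (fun t => reC (c * pder a F (plane u b a t s))) =
    (fun t => reC (c * pder a F (plane u a b s t)))); last first.
    by apply/funext => t'; rewrite planeC.
  rewrite [plane u b a t s]planeC //; apply; exact: regular_pderivable rF' (DP s t hs ht).
by exists s, t.
Qed.

(** By [second_difference] applied in both orders, in every small square at u
    the two mixed derivatives take, at some points, values with the same real
    part; both are continuous at u.  Multiplying by all constants c upgrades
    equality of real parts to equality. *)
Lemma pderC D F a b u : open D -> regular D F -> D u ->
  pder a (pder b F) u = pder b (pder a F) u.
Proof.
move=> oD rF Du; have [->//|ab] := eqVneq a b.
apply: (cp_inj CP) => c.
apply/eqP; rewrite -subr_eq0 -normr_eq0 eq_le normr_ge0 andbT.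
apply/ler_addgt0Pl => e e0; rewrite addr0.
pose P v := reC (c * pder a (pder b F) v); pose Q v := reC (c * pder b (pder a F) v).
have cont G : regular D G -> {for u, continuous (fun v => reC (c * G v))}.
  move=> rG; apply: (continuous_comp (g := fun y : C => reC (c * y))).
    exact: (regular_continuous rG).
  apply: (continuous_comp (f := fun y : C => c * y)); last exact: reC_continuous.
  exact: mulrl_continuous.
have cP := cont _ (regular_pder a (regular_pder b rF)).
have cQ := cont _ (regular_pder b (regular_pder a rF)).
have e2 : 0 < e / 2 by rewrite divr_gt0.
have nearu : \forall v \near u, [/\ D v, `|P u - P v| < e / 2 & `|Q u - Q v| < e / 2].
  have nP : \forall v \near u, `|P u - P v| < e / 2 by move/cvgrPdist_lt: cP; apply.
  have nQ : \forall v \near u, `|Q u - Q v| < e / 2 by move/cvgrPdist_lt: cQ; apply.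
  have nD : \forall v \near u, D v by exact: open_nbhs_nbhs.
  by apply: filterS3 nD nP nQ => v.
have [[A B] [/= nA nB] AB] := plane_cvg ab nearu.
(* a square with corner u on which all three conditions hold *)
have [r r0 Hr] : exists2 r : R, 0 < r & forall s, 0 <= s <= r / 2 -> A s /\ B s.
  have /nbhs_ballP[r r0 Hr] : nbhs (0 : R) (A `&` B) by exact: filterI.
  exists r => // s /andP[s0 sr]; apply: Hr; rewrite /ball /= sub0r normrN ger0_norm //.
  move: r0; rewrite /= => r0; lra.
have Hplane s t : 0 <= s <= r / 2 -> 0 <= t <= r / 2 ->
   [/\ D (plane u a b s t), `|P u - P (plane u a b s t)| < e / 2 &
       `|Q u - Q (plane u a b s t)| < e / 2].
  by move=> /Hr[As _] /Hr[_ Bt]; exact: (AB (s, t)).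
have h0 : 0 < r / 2 by rewrite divr_gt0.
have [s [t [hs ht E]]] := @second_difference D F c u a b (r / 2) ab h0 rF
   (fun s t hs ht => let: And3 H _ _ := Hplane s t hs ht in H).
have ba : b != a by rewrite eq_sym.
have [t' [s' [ht' hs' E']]] := @second_difference D F c u b a (r / 2) ba h0 rF
   (fun t s ht hs => ltac:(by rewrite planeC //; case: (Hplane s t hs ht))).
rewrite !(planeC _ _ _ ba) in E'.
(* the second differences in the two orders are equal *)
have PQ : P (plane u a b s' t') = Q (plane u a b s t).
  have nz : r / 2 != 0 by rewrite gt_eqF.
  apply: (mulIf nz); apply: (mulIf nz).
  apply: etrans (esym E') _; apply: etrans _ E; ring.
have [_ _ HQ] := Hplane s t hs ht; have [_ HP _] := Hplane s' t' hs' ht'.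
exact: (dist_le_half (eq_ind _ (fun z => `|P u - z| < e / 2) HP _ PQ) HQ).
Qed.
End RealPart.

(** * The ring of regular functions on an open set *)

(** Nonempty open sets of jets; the point serves to extend functions from the
    set to the whole jet space in a definite way. *)
Record jet_domain (I : finType) (C : numClosedFieldType) := JetDomain {
  dom_set : set (jet I C);
  dom_open : open dom_set;
  dom_pt : jet I C;
  dom_ptP : dom_set dom_pt }.

Section RegularRing.
Variables (I : finType) (C : numClosedFieldType) (O : jet_domain I C).
Local Notation jet := (jet I C).
Local Notation fct := (jet -> C).
Local Notation D := (dom_set O).
Let oD : open D := dom_open O.
Implicit Types (F G : fct) (u v : jet) (a b : I * nat).

Definition retract u : jet := if `[< D u >] then u else dom_pt O.

Lemma retractP u : D (retract u).
Proof. by rewrite /retract; case: asboolP => // _; exact: dom_ptP. Qed.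

Lemma retract_id u : D u -> retract u = u.
Proof. by move=> Du; rewrite /retract asboolT. Qed.

(** A regular function matters only through its values on D.  Composing it with
    a retraction onto D selects one representative among all the functions with
    the same values on D, so that equality in [regfun] is Leibniz equality. *)
Definition retracted : {pred fct} :=
  fun F => `[< exists2 f, regular D f & F = f \o retract >].

Lemma retractedP F : reflect (exists2 f, regular D f & F = f \o retract) (F \in retracted).
Proof. exact: asboolP. Qed.

Lemma retracted_subring : subring_closed retracted.
Proof.
split.
- by apply/retractedP; exists (cst 1); [exact: regular_cst|].
- move=> _ _ /retractedP[f rf ->] /retractedP[g rg ->]; apply/retractedP.
  by exists (f - g); [exact: (regularD oD rf (regularN oD rg))|].
- move=> _ _ /retractedP[f rf ->] /retractedP[g rg ->]; apply/retractedP.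
  by exists (f * g); [exact: (regularM oD rf rg)|].
Qed.
HB.instance Definition _ := GRing.isSubringClosed.Build fct retracted retracted_subring.

Record regfun := Regfun { regfun_val : fct; regfun_prop : regfun_val \in retracted }.
HB.instance Definition _ := [isSub for regfun_val].
HB.instance Definition _ := [Choice of regfun by <:].
HB.instance Definition _ := [SubChoice_isSubComNzRing of regfun by <:].

Implicit Types (x y : regfun).

(** The link between actual functions and elements of the ring: a relation
    rather than a map, as several functions have the same values on D. *)
Definition represents F x : Prop := regular D F /\ forall u, D u -> F u = val x u.

Lemma represented x : exists F, represents F x.
Proof.
have /retractedP[f rf E] := valP x; exists f; split=> // u Du.
by rewrite E /= retract_id.
Qed.

Lemma representable F : regular D F -> exists x, represents F x.
Proof.
move=> rF; have gF : F \o retract \in retracted by apply/retractedP; exists F.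
by exists (Regfun gF); split=> // u Du; rewrite /= retract_id.
Qed.

Lemma represents_inj F G x y : represents F x -> represents G y ->
  (forall u, D u -> F u = G u) -> x = y.
Proof.
move=> [_ Fx] [_ Gy] FG; apply: val_inj; apply/funext => u.
have retr (z : regfun) : val z u = val z (retract u).
  by have /retractedP[f rf ->] := valP z; rewrite /= (retract_id (retractP u)).
by rewrite !retr -Fx ?FG ?Gy //; exact: retractP.
Qed.

Lemma represents_uniq F x y : represents F x -> represents F y -> x = y.
Proof. by move=> Fx Fy; apply: represents_inj Fx Fy _. Qed.

Lemma represents0 : represents 0 0.
Proof. by split=> //; exact: (regular_cst oD 0). Qed.
Lemma represents1 : represents 1 1.
Proof. by split=> //; exact: (regular_cst oD 1). Qed.
Lemma representsD F G x y : represents F x -> represents G y -> represents (F + G) (x + y).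
Proof.
by move=> [rF Fx] [rG Gy]; split=> [|u Du]; [exact: regularD|rewrite !fctE Fx ?Gy].
Qed.
Lemma representsN F x : represents F x -> represents (- F) (- x).
Proof.
by move=> [rF Fx]; split=> [|u Du]; [exact: regularN|rewrite !fctE Fx].
Qed.
Lemma representsM F G x y : represents F x -> represents G y -> represents (F * G) (x * y).
Proof.
by move=> [rF Fx] [rG Gy]; split=> [|u Du]; [exact: regularM|rewrite !fctE Fx ?Gy].
Qed.
Lemma represents_sum (J : finType) (F : J -> fct) (x : J -> regfun) :
  (forall j, represents (F j) (x j)) -> represents (\sum_j F j) (\sum_j x j).
Proof.
move=> Fx; apply: (big_ind2 represents represents0) => //.
by move=> ? ? ? ?; exact: representsD.
Qed.

Definition regfun_of F (rF : regular D F) : regfun := projT1 (cid (representable rF)).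
Lemma regfun_of_represents F (rF : regular D F) : represents F (regfun_of rF).
Proof. exact: projT2 (cid (representable rF)). Qed.

Definition regfun_rep x : fct := projT1 (cid (represented x)).
Lemma regfun_rep_represents x : represents (regfun_rep x) x.
Proof. exact: projT2 (cid (represented x)). Qed.
Lemma regfun_rep_regular x : regular D (regfun_rep x).
Proof. exact: (regfun_rep_represents x).1. Qed.

Definition regpder a x : regfun := regfun_of (regular_pder a (regfun_rep_regular x)).
Definition regDtot x : regfun := regfun_of (regular_Dtot oD (regfun_rep_regular x)).
Definition regfld a : regfun := regfun_of (regular_fld oD a.1 a.2).

Lemma represents_pder F x a : represents F x -> represents (pder a F) (regpder a x).
Proof.
move=> [rF Fx]; have [rG Gx] := regfun_rep_represents x; split; first exact: regular_pder.
move=> u Du; rewrite -(regfun_of_represents (regular_pder a (regfun_rep_regular x))).2 //.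
by apply: (eq_on_pder a oD) Du => v Dv; rewrite Fx ?Gx.
Qed.

Lemma represents_Dtot F x : represents F x -> represents (Dtot F) (regDtot x).
Proof.
move=> Fx; have [rF _] := Fx; split; first exact: regular_Dtot.
move=> u Du; rewrite -(regfun_of_represents (regular_Dtot oD (regfun_rep_regular x))).2 //.
rewrite /Dtot; apply: eq_fsbigr => a _; congr (_ * _).
rewrite (represents_pder a Fx).2 // (represents_pder a (regfun_rep_represents x)).2 //.
Qed.

Lemma represents_fld i n : represents (fld i n) (regfld (i, n)).
Proof. exact: regfun_of_represents. Qed.

Lemma regpder_is_additive a : zmod_morphism (regpder a).
Proof.
move=> x y; have [Fx Gy] := (regfun_rep_represents x, regfun_rep_represents y).
apply: represents_inj (represents_pder a (representsD Fx (representsN Gy)))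
  (representsD (represents_pder a Fx) (representsN (represents_pder a Gy))) _ => u Du.
have dF : pderivable a (regfun_rep x) u := regular_pderivable Fx.1 Du.
have dG : pderivable a (regfun_rep y) u := regular_pderivable Gy.1 Du.
by have [dN E] := pderN dG; rewrite (pderD dF dN).2 E.
Qed.
HB.instance Definition _ a := GRing.isZmodMorphism.Build _ _ (regpder a) (regpder_is_additive a).

Lemma regpderM a x y : regpder a (x * y) = regpder a x * y + x * regpder a y.
Proof.
have [Fx Gy] := (regfun_rep_represents x, regfun_rep_represents y).
apply: represents_inj (represents_pder a (representsM Fx Gy))
  (representsD (representsM (represents_pder a Fx) Gy)
               (representsM Fx (represents_pder a Gy))) _ => u Du.
have dF : pderivable a (regfun_rep x) u := regular_pderivable Fx.1 Du.
have dG : pderivable a (regfun_rep y) u := regular_pderivable Gy.1 Du.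
by rewrite (pderM dF dG).2.
Qed.

Lemma regpder_fld a b : regpder a (regfld b) = (a == b)%:R.
Proof.
case: b => i n.
have c : represents (cst (a == (i, n))%:R) (a == (i, n))%:R.
  by case: (a == _); [exact: represents1|exact: represents0].
apply: represents_inj (represents_pder a (represents_fld i n)) c _ => u Du.
exact: (pder_fld a i n u).2.
Qed.

Lemma represents_bound F x : represents F x ->
  exists N, forall a, (N <= a.2)%N -> pder a F = 0 /\ regpder a x = 0.
Proof.
move=> Fx; have [[[N hN] _] _] := Fx; exists N => a le.
have F0 := pder_high hN le; split=> //.
apply: represents_uniq represents0.
by rewrite -F0; exact: represents_pder.
Qed.

Lemma regpder_fin x : exists N, forall a, (N <= a.2)%N -> regpder a x = 0.
Proof.
have [N hN] := represents_bound (regfun_rep_represents x).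
by exists N => a /hN[].
Qed.

(** The total derivative is a finite sum, which can be cut at any bound on the
    order of x and not only at one valid for a chosen representative. *)
Lemma regDtotE x N : (forall a, (N <= a.2)%N -> regpder a x = 0) ->
  regDtot x = \sum_i \sum_(n < N) regfld (i, n.+1) * regpder (i, val n) x.
Proof.
move=> hN; have Fx := regfun_rep_represents x; set F := regfun_rep x in Fx.
have [[[M hM] _] _] := Fx.
transitivity (\sum_i \sum_(n < maxn N M) regfld (i, n.+1) * regpder (i, val n) x).
  apply: represents_uniq (represents_Dtot Fx) _.
  have hM' u v : (forall a, (a.2 < maxn N M)%N -> u a = v a) -> F u = F v.
    by move=> uv; apply: hM => a lt; apply: uv; rewrite leq_max lt orbT.
  rewrite (Dtot_sum hM'); apply: represents_sum => i; apply: represents_sum => n.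
  exact: (representsM (represents_fld _ _) (represents_pder _ Fx)).
apply: eq_bigr => i _.
rewrite [RHS](big_ord_widen (maxn N M) (fun n => regfld (i, n.+1) * regpder (i, n) x)) ?leq_maxl //.
rewrite [RHS]big_mkcond; apply: eq_bigr => n _ /=; case: ltnP => // le.
by rewrite hN // mulr0.
Qed.

Lemma regDtot_is_additive : zmod_morphism regDtot.
Proof.
move=> x y; have [[N hN] [M hM]] := (regpder_fin x, regpder_fin y).
pose K := maxn N M.
have hx a : (K <= a.2)%N -> regpder a x = 0 by rewrite geq_max => /andP[/hN].
have hy a : (K <= a.2)%N -> regpder a y = 0 by rewrite geq_max => /andP[_ /hM].
have hxy a : (K <= a.2)%N -> regpder a (x - y) = 0.
  by move=> le; rewrite raddfB /= hx // hy // subr0.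
rewrite (regDtotE hx) (regDtotE hy) (regDtotE hxy) -sumrB; apply: eq_bigr => i _.
by rewrite -sumrB; apply: eq_bigr => n _; rewrite raddfB /= mulrBr.
Qed.
HB.instance Definition _ := GRing.isZmodMorphism.Build _ _ regDtot regDtot_is_additive.

Lemma regDtotM x y : regDtot (x * y) = regDtot x * y + x * regDtot y.
Proof.
have [[N hN] [M hM]] := (regpder_fin x, regpder_fin y).
pose K := maxn N M.
have hx a : (K <= a.2)%N -> regpder a x = 0 by rewrite geq_max => /andP[/hN].
have hy a : (K <= a.2)%N -> regpder a y = 0 by rewrite geq_max => /andP[_ /hM].
have hxy a : (K <= a.2)%N -> regpder a (x * y) = 0.
  by move=> le; rewrite regpderM hx // hy // mul0r mulr0 addr0.
rewrite (regDtotE hx) (regDtotE hy) (regDtotE hxy) mulr_suml mulr_sumr -big_split.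
apply: eq_bigr => i _; rewrite mulr_suml mulr_sumr -big_split.
by apply: eq_bigr => n _ /=; rewrite regpderM mulrDr mulrA mulrCA.
Qed.

Hypothesis schwarz : forall F a b u, regular D F -> D u ->
  pder a (pder b F) u = pder b (pder a F) u.

Lemma regpderC a b x : regpder a (regpder b x) = regpder b (regpder a x).
Proof.
have Fx := regfun_rep_represents x.
apply: represents_inj (represents_pder a (represents_pder b Fx))
  (represents_pder b (represents_pder a Fx)) _ => u Du.
exact: schwarz Fx.1 Du.
Qed.

(** The partial derivative of u_i^{(n+1)} dx/du_i^{(n)} is the sum of two terms,
    the second of which is nonzero only for b = (i, n + 1). *)
Lemma regpder_Dtot b x N : (forall a, (N <= a.2)%N -> regpder a x = 0) ->
  regpder b (regDtot x) = regDtot (regpder b x)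
    + \sum_i \sum_(n < N) (b == (i, n.+1))%:R * regpder (i, val n) x.
Proof.
move=> hN; have hbN a : (N <= a.2)%N -> regpder a (regpder b x) = 0.
  by move=> le; rewrite regpderC hN // raddf0.
rewrite (regDtotE hN) (regDtotE hbN) raddf_sum -big_split; apply: eq_bigr => i _ /=.
rewrite raddf_sum -big_split; apply: eq_bigr => n _ /=.
by rewrite regpderM regpder_fld addrC regpderC.
Qed.

(** Symmetry of second derivatives is the only analytic input; the remaining
    rules are those of first-order calculus. *)
Lemma differential_regfun : differential_functions regDtot regpder regfld.
Proof.
split.
- exact: regDtotM.
- exact: regpderM.
- exact: regpderC.
- move=> i x; have [N hN] := regpder_fin x; rewrite /= (regpder_Dtot _ hN).
  rewrite [X in _ + X]big1 ?addr0 // => j _; rewrite big1 // => n _.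
  by rewrite xpair_eqE andbF mul0r.
- move=> i n x; have [N hN] := regpder_fin x; rewrite /= (regpder_Dtot _ hN).
  congr (_ + _); rewrite (bigD1 i) //= [X in _ + X]big1 ?addr0; last first.
    move=> j ji; rewrite big1 // => m _.
    by rewrite xpair_eqE eq_sym (negPf ji) mul0r.
  have [lt|le] := ltnP n N.
    rewrite (bigD1 (Ordinal lt)) //= eqxx mul1r big1 ?addr0 // => m mn.
    rewrite xpair_eqE eqxx /= eqSS (_ : (n == m) = false) ?mul0r //.
    by apply/negbTE; apply: contraNN mn => /eqP nm; apply/eqP/val_inj.
  rewrite hN // big1 // => m _; rewrite xpair_eqE eqxx eqSS /=.
  by rewrite gtn_eqF ?mul0r // (leq_trans (ltn_ord m)).
- exact: regpder_fin.
- exact: regpder_fld.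
- move=> i n; apply: represents_uniq (represents_Dtot (represents_fld i n)) _.
  split=> [|u Du]; first by apply: regular_Dtot => //; exact: regular_fld.
  rewrite -(represents_fld i n.+1).2 //.
  have hN u' v : (forall a, (a.2 < n.+1)%N -> u' a = v a) -> fld i n u' = fld i n v :> C.
    by move=> uv; apply: (uv (i, n)).
  rewrite (Dtot_sum hN) fct_sumE (bigD1 i) //= [X in _ + X]big1 ?addr0.
    rewrite fct_sumE big_ord_recr /= big1 ?add0r => [|m _].
      by rewrite /= !fctE (pder_fld (i, n) i n u).2 eqxx mulr1.
    by rewrite !fctE (pder_fld _ i n u).2 xpair_eqE [_ == n](ltn_eqF (ltn_ord m)) andbF mulr0.
  move=> j ji; rewrite fct_sumE big1 // => m _.
  by rewrite !fctE (pder_fld _ i n u).2 xpair_eqE (negPf ji) mulr0.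
Qed.
End RegularRing.

(** * Transfer of the formal operations along a relation *)

(** All the operations on distributions are built from ring operations and
    derivatives of the coefficients, so they preserve any relation between two
    rings that is compatible with these.  The relation is [represents] when
    an identity is carried from the ring [regfun] to functions on D. *)
Section Transfer.
Variables (V W : nzRingType) (d : V -> V) (e : W -> W) (Rel : V -> W -> Prop).

Record compatible : Prop := {
  cm_0 : Rel 0 0;
  cm_D : forall f g v w, Rel f v -> Rel g w -> Rel (f + g) (v + w);
  cm_N : forall f v, Rel f v -> Rel (- f) (- v);
  cm_M : forall f g v w, Rel f v -> Rel g w -> Rel (f * g) (v * w);
  cm_d : forall f v, Rel f v -> Rel (d f) (e v);
  cm_d0 : d 0 = 0;
  cm_e0 : e 0 = 0 }.

Definition prel (E : {poly V}) (F : {poly W}) := forall k, Rel E`_k F`_k.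

Hypothesis cm : compatible.

Lemma cm_Mn f v n : Rel f v -> Rel (f *+ n) (v *+ n).
Proof.
move=> fv; elim: n => [|n IHn]; first exact: cm_0 cm.
by rewrite !mulrS; apply: cm_D.
Qed.

Lemma cm_sum (J : finType) (F : J -> V) (G : J -> W) :
  (forall j, Rel (F j) (G j)) -> Rel (\sum_j F j) (\sum_j G j).
Proof.
move=> FG; apply: (big_ind2 Rel) => //; first exact: cm_0.
by move=> ? ? ? ?; exact: cm_D.
Qed.

Lemma prel0 : prel 0 0.
Proof. by move=> k; rewrite !coef0; exact: cm_0. Qed.

Lemma prelD E E' F F' : prel E F -> prel E' F' -> prel (E + E') (F + F').
Proof. by move=> H H' k; rewrite !coefD; exact: cm_D. Qed.

Lemma prelN E F : prel E F -> prel (- E) (- F).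
Proof. by move=> H k; rewrite !coefN; exact: cm_N. Qed.

Lemma prelM E E' F F' : prel E F -> prel E' F' -> prel (E * E') (F * F').
Proof. by move=> H H' k; rewrite !coefM; apply: cm_sum => j; exact: cm_M. Qed.

Lemma prelZ f v E F : Rel f v -> prel E F -> prel (f *: E) (v *: F).
Proof. by move=> H H' k; rewrite !coefZ; exact: cm_M. Qed.

Lemma prelMX E F : prel E F -> prel (E * 'X) (F * 'X).
Proof. by move=> H k; rewrite !coefMX; case: eqP => // _; exact: cm_0. Qed.

Lemma prelZXn f v k : Rel f v -> prel (f *: 'X^k) (v *: 'X^k).
Proof.
move=> H j; rewrite !coefZ !coefXn; case: eqP => _; rewrite ?mulr1 ?mulr0 //.
exact: cm_0.
Qed.

Lemma prel_sum (J : finType) (E : J -> {poly V}) (F : J -> {poly W}) :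
  (forall j, prel (E j) (F j)) -> prel (\sum_j E j) (\sum_j F j).
Proof.
move=> EF; apply: (big_ind2 prel) => //; first exact: prel0.
by move=> ? ? ? ?; exact: prelD.
Qed.

Lemma prel_dx E F : prel E F -> prel (dx d E) (dx e F).
Proof.
move=> H; apply: prelD; last exact: prelMX.
by move=> k; rewrite !coef_map_id0 ?(cm_d0 cm) ?(cm_e0 cm) //; exact: cm_d.
Qed.

Lemma prel_dy E F : prel E F -> prel (dy E) (dy F).
Proof. by move=> H; apply: prelN; exact: prelMX. Qed.

Lemma cm_iter_d n f v : Rel f v -> Rel (iter n d f) (iter n e v).
Proof. by move=> H; elim: n => //= n IHn; exact: cm_d. Qed.

Lemma prel_iter_dx n E F : prel E F -> prel (iter n (dx d) E) (iter n (dx e) F).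
Proof. by move=> H; elim: n => //= n IHn; exact: prel_dx. Qed.

Lemma prel_iter_dy n E F : prel E F -> prel (iter n (@dy V) E) (iter n (@dy W) F).
Proof. by move=> H; elim: n => //= n IHn; exact: prel_dy. Qed.

Lemma prel_ydelta f v k : Rel f v -> prel (ydelta d f k) (ydelta e v k).
Proof.
move=> H; apply: prel_sum => j; apply: prelZXn.
by apply: cm_Mn; exact: cm_iter_d.
Qed.

Lemma ydelta_0 (U : nzRingType) (D : U -> U) k : D 0 = 0 -> ydelta D 0 k = 0.
Proof.
move=> D0; rewrite /ydelta big1 // => j _.
suff -> : iter (k - j) D 0 = 0 by rewrite mul0rn scale0r.
by elim: (k - j)%N => //= n ->.
Qed.

Lemma big_coef_widen (U : nzRingType) (E : {poly U}) (F : nat -> {poly U}) N :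
  (size E <= N)%N -> (forall k, (size E <= k)%N -> F k = 0) ->
  \sum_(k < size E) F k = \sum_(k < N) F k.
Proof.
move=> le F0; rewrite (big_ord_widen N F le) big_mkcond; apply: eq_bigr => k _.
by case: ltnP => // /F0.
Qed.

(** Related polynomials may have different sizes: a nonzero function can be
    related to zero.  Hence the padding to a common size. *)
Lemma prel_aty f v E F : Rel f v -> prel E F -> prel (aty d f E) (aty e v F).
Proof.
move=> fv EF; rewrite /aty; set N := maxn (size E) (size F).
rewrite (@big_coef_widen _ E (fun k => E`_k *: ydelta d f k) N) ?leq_maxl //; last first.
  by move=> k le; rewrite nth_default ?scale0r.
rewrite (@big_coef_widen _ F (fun k => F`_k *: ydelta e v k) N) ?leq_maxr //; last first.
  by move=> k le; rewrite nth_default ?scale0r.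
by apply: prel_sum => k; apply: prelZ => //; exact: prel_ydelta.
Qed.

Lemma prel_sign n E F : prel E F -> prel ((-1) ^+ n *: E) ((-1) ^+ n *: F).
Proof.
by move=> EF; rewrite -signr_odd -[in X in prel _ X]signr_odd; case: odd;
  rewrite ?scale1r ?scaleN1r //; exact: prelN.
Qed.

Lemma prel_flip E F : prel E F -> prel (flip d E) (flip e F).
Proof.
move=> EF; rewrite /flip; set N := maxn (size E) (size F).
rewrite (@big_coef_widen _ E (fun k => (-1) ^+ k *: ydelta d E`_k k) N) ?leq_maxl //; last first.
  by move=> k le; rewrite nth_default ?ydelta_0 ?scaler0 //; exact: cm_d0.
rewrite (@big_coef_widen _ F (fun k => (-1) ^+ k *: ydelta e F`_k k) N) ?leq_maxr //; last first.
  by move=> k le; rewrite nth_default ?ydelta_0 ?scaler0 //; exact: cm_e0.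
by apply: prel_sum => k; apply: prel_sign; exact: prel_ydelta.
Qed.
End Transfer.

Section TransferBracket.
Variables (I : finType) (V W : comNzRingType) (d : V -> V) (e : W -> W).
Variables (pd : I * nat -> V -> V) (pe : I * nat -> W -> W) (Rel : V -> W -> Prop).
Hypothesis cm : compatible d e Rel.
Hypothesis cm_pd : forall a f v, Rel f v -> Rel (pd a f) (pe a v).
Hypothesis cm_bound : forall f v, Rel f v ->
  exists N, forall a, (N <= a.2)%N -> pd a f = 0 /\ pe a v = 0.
Hypothesis pd0 : forall a, pd a 0 = 0.
Hypothesis pe0 : forall a, pe a 0 = 0.

(** Distributions in three variables are distributions in two variables over
    the polynomial ring, so the results above apply to them again. *)
Lemma compatible_poly : compatible (dx d) (dx e) (prel Rel).
Proof.
split.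
- exact: (prel0 cm).
- by move=> ? ? ? ?; exact: (prelD cm).
- by move=> ? ?; exact: (prelN cm).
- by move=> ? ? ? ?; exact: (prelM cm).
- by move=> ? ?; exact: (prel_dx cm).
- by apply/polyP=> k; rewrite /dx map_poly0 mul0r addr0.
- by apply/polyP=> k; rewrite /dx map_poly0 mul0r addr0.
Qed.

Section Bracket.
Variables (P : I -> I -> {poly V}) (Q : I -> I -> {poly W}).
Hypothesis PQ : forall i j, prel Rel (P i j) (Q i j).

Lemma prel_bracket A B v w : Rel A v -> Rel B w ->
  prel Rel (formal_bracket d pd P A B) (formal_bracket e pe Q v w).
Proof.
move=> Av Bw; have [[N hN] [M hM]] := (cm_bound Av, cm_bound Bw).
rewrite /formal_bracket !(@fsum_jets _ _ _ N).
- apply: (prel_sum cm) => i; apply: (prel_sum cm) => n; rewrite !(@fsum_jets _ _ _ M).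
  + apply: (prel_sum cm) => j; apply: (prel_sum cm) => m.
    apply: (prelZ cm); first exact: cm_pd.
    apply: (prel_aty cm); first exact: cm_pd.
    by apply: (prel_iter_dx cm); apply: (prel_iter_dy cm).
  + move=> b /hM[_ ->]; rewrite (_ : aty _ _ _ = 0) ?scaler0 //.
    rewrite /aty big1 // => k _; rewrite ydelta_0 ?scaler0 //; exact: cm_e0 cm.
  + move=> b /hM[-> _]; rewrite (_ : aty _ _ _ = 0) ?scaler0 //.
    rewrite /aty big1 // => k _; rewrite ydelta_0 ?scaler0 //; exact: cm_d0 cm.
- by move=> a /hN[_ ->]; apply: fsbig1 => b _; rewrite scale0r.
- by move=> a /hN[-> _]; apply: fsbig1 => b _; rewrite scale0r.
Qed.

End Bracket.
End TransferBracket.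

(** * Poisson structures determined by the brackets of the fields *)

Section PoissonTransfer.
Variables (I : finType) (C : numClosedFieldType).
Local Notation jet := (jet I C).
Local Notation fct := (jet -> C).
Implicit Types (A B E : fct).

Lemma pder0 a : pder a (0 : fct) = 0.
Proof. exact: (@pder_high _ _ 0 0%N). Qed.

Lemma Dtot0 : Dtot (0 : fct) = 0.
Proof. by apply/funext => u; apply: fsbig1 => a _; rewrite pder0 mulr0. Qed.

Lemma bracket0 (P : I -> I -> dist2 I C) B : bracket P 0 B = 0.
Proof.
by apply: fsbig1 => a _; apply: fsbig1 => b _; rewrite pder0 scale0r.
Qed.

Lemma set0_regular F : regular (set0 : set jet) F <-> finite_order F.
Proof. by split=> [[]|]. Qed.

(** On the empty set regularity is finite order, so this is the transfer
    principle for the relation that only asks the left side to be regular on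
    the empty set; the right side is a dummy. *)
Lemma finite_order_bracket (P : I -> I -> dist2 I C) A B :
  (forall i j k, finite_order (P i j)`_k) -> finite_order A -> finite_order B ->
  forall k, finite_order (bracket P A B)`_k.
Proof.
move=> foP foA foB k; apply/set0_regular.
pose Rel := fun (F : fct) (n : int) => regular (set0 : set jet) F.
have o0 : open (set0 : set jet) := open0.
have cm : compatible (@Dtot I C) (fun=> 0) Rel.
  split.
  - exact: (regular_cst o0 0).
  - by move=> ? ? ? ?; exact: (regularD o0).
  - by move=> ? ?; exact: (regularN o0).
  - by move=> ? ? ? ?; exact: (regularM o0).
  - by move=> ? ?; exact: (regular_Dtot o0).
  - exact: Dtot0.
  - by [].
apply: (@prel_bracket I _ _ _ _ (@pder I C) (fun _ _ => 0) Rel cm _ _ P (fun _ _ => 0) _ A B 0 0).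
- by move=> a f ?; exact: regular_pder.
- move=> F _ [[N hN] _]; exists N => a le; split=> //; exact: pder_high hN a le.
- by move=> i j l; apply/set0_regular.
- exact/set0_regular.
- exact/set0_regular.
Qed.

Section Represented.
Variable O : jet_domain I C.
Local Notation D := (dom_set O).
Local Notation W := (regfun O).
Let oD : open D := dom_open O.

Hypothesis schwarz : forall F a b u, regular D F -> D u ->
  pder a (pder b F) u = pder b (pder a F) u.

Lemma compatible_represents : compatible (@Dtot I C) (@regDtot I C O) (@represents I C O).
Proof.
split.
- exact: represents0.
- by move=> ? ? ? ?; exact: representsD.
- by move=> ? ?; exact: representsN.
- by move=> ? ? ? ?; exact: representsM.
- by move=> ? ?; exact: represents_Dtot.
- exact: Dtot0.
- exact: raddf0.
Qed.
Let cm := compatible_represents.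
Let cm2 := compatible_poly cm.

Local Notation pR := (prel (@represents I C O)).
Local Notation ppR := (prel (prel (@represents I C O))).
Local Notation DtotA := (@regDtot I C O : {additive W -> W}).
Local Notation pderA := (fun a => @regpder I C O a : {additive W -> W}).

Lemma prel_eq2 (E F : dist2 I C) (E' F' : {poly W}) :
  pR E E' -> pR F F' -> E' = F' -> eq2 D E F.
Proof.
move=> EE FF EF k u Du; rewrite -EF in FF.
by have [[_ HE] [_ HF]] := (EE k, FF k); apply: etrans (HE u Du) (esym (HF u Du)).
Qed.

Lemma prel_eq3 (E F : dist3 I C) (E' F' : {poly {poly W}}) :
  ppR E E' -> ppR F F' -> E' = F' -> eq3 D E F.
Proof.
move=> EE FF EF k l u Du; rewrite -EF in FF.
by have [[_ HE] [_ HF]] := (EE k l, FF k l); apply: etrans (HE u Du) (esym (HF u Du)).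
Qed.

Variables (P : I -> I -> dist2 I C) (Q : I -> I -> {poly W}).
Hypothesis PQ : forall i j, pR (P i j) (Q i j).

Lemma bracket_represents A B v w : represents A v -> represents B w ->
  pR (bracket P A B) (br DtotA pderA Q v w).
Proof.
move=> Av Bw; rewrite -(formal_bracketE (differential_regfun schwarz)).
apply: (prel_bracket cm) Av Bw => //.
- by move=> a f x; exact: represents_pder.
- exact: represents_bound.
Qed.

Lemma bracket3_represents A B E v w z :
  represents A v -> represents B w -> represents E z ->
  ppR (bracket3 P A B E) (br3 DtotA pderA Q v w z).
Proof.
move=> Av Bw Ez k; rewrite (coef_br3 (differential_regfun schwarz)).
rewrite coef_map_id0 ?bracket0 //; apply: bracket_represents => //.
exact: bracket_represents.
Qed.

Lemma cyc_represents (E : dist3 I C) (F : {poly {poly W}}) : ppR E F -> ppR (cyc E) (cyc3 DtotA F).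
Proof.
move=> EF; apply: (prel_flip cm2) => k l; rewrite !coef_swapXY; exact: EF.
Qed.

Lemma represents_cst (c : C) : exists z, [/\ represents (cst c) z,
  (forall a, pderA a z = 0) & DtotA z = 0].
Proof.
have [z cz] := representable (regular_cst oD c); exists z.
have z0 a : pderA a z = 0.
  apply: represents_uniq (represents0 O).
  have <- : pder a (cst c) = (0 : fct) by exact: (@pder_high _ _ (cst c) 0%N).
  exact: represents_pder.
split=> //=; rewrite (@regDtotE _ _ _ _ 0) => [|a _]; last exact: z0.
by rewrite big1 // => i _; rewrite big_ord0.
Qed.

Hypothesis skewQ : forall i j, Q i j = - flip DtotA (Q j i).
Hypothesis jacobiQ : forall i j k,
  jacobiator DtotA pderA Q (regfld O (i, 0%N)) (regfld O (j, 0%N)) (regfld O (k, 0%N)) = 0.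

(** Each axiom is an identity between related expressions, which holds in
    [regfun]; regularity of the coefficients is part of [represents]. *)
Lemma poisson_transfer : poisson_structure D P.
Proof.
have df := differential_regfun schwarz.
have rp := @representable I C O.
have bR := bracket_represents.
split.
- by move=> A B /rp[v Av] /rp[w Bw] k; have [] := bR _ _ _ _ Av Bw k.
- move=> i j; have fi := represents_fld O i 0; have fj := represents_fld O j 0.
  by apply: prel_eq2 (bR _ _ _ _ fi fj) (PQ i j) _; exact: (br_x df).
- move=> A B E /rp[v Av] /rp[w Bw] /rp[z Ez].
  apply: prel_eq2 (bR _ _ _ _ (representsD Av Bw) Ez)
    (prelD cm (bR _ _ _ _ Av Ez) (bR _ _ _ _ Bw Ez)) _; exact: (brDl df).
- move=> A B E /rp[v Av] /rp[w Bw] /rp[z Ez].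
  apply: prel_eq2 (bR _ _ _ _ Ez (representsD Av Bw))
    (prelD cm (bR _ _ _ _ Ez Av) (bR _ _ _ _ Ez Bw)) _; exact: (brDr df).
- move=> c A B /rp[v Av] /rp[w Bw]; have [z [cz z0 dz]] := represents_cst c.
  apply: prel_eq2 (bR _ _ _ _ (representsM cz Av) Bw)
    (prelZ cm cz (bR _ _ _ _ Av Bw)) _; exact: (br_constl df).
- move=> c A B /rp[v Av] /rp[w Bw]; have [z [cz z0 dz]] := represents_cst c.
  apply: prel_eq2 (bR _ _ _ _ Av (representsM cz Bw))
    (prelZ cm cz (bR _ _ _ _ Av Bw)) _; exact: (br_constr df).
- move=> A B E /rp[v Av] /rp[w Bw] /rp[z Ez].
  apply: prel_eq2 (bR _ _ _ _ (representsM Av Bw) Ez)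
    (prelD cm (prelZ cm Av (bR _ _ _ _ Bw Ez)) (prelZ cm Bw (bR _ _ _ _ Av Ez))) _.
  exact: (brMl df).
- move=> A B E /rp[v Av] /rp[w Bw] /rp[z Ez].
  apply: prel_eq2 (bR _ _ _ _ Ez (representsM Av Bw))
    (prelD cm (prel_aty cm Av (bR _ _ _ _ Ez Bw)) (prel_aty cm Bw (bR _ _ _ _ Ez Av))) _.
  exact: (brMr df).
- move=> A B /rp[v Av] /rp[w Bw].
  apply: prel_eq2 (bR _ _ _ _ (represents_Dtot Av) Bw) (prel_dx cm (bR _ _ _ _ Av Bw)) _.
  exact: (br_dl df).
- move=> A B /rp[v Av] /rp[w Bw].
  apply: prel_eq2 (bR _ _ _ _ Av (represents_Dtot Bw)) (prel_dy cm (bR _ _ _ _ Av Bw)) _.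
  exact: (br_dr df).
- move=> A B /rp[v Av] /rp[w Bw].
  apply: prel_eq2 (bR _ _ _ _ Av Bw) (prelN cm (prel_flip cm (bR _ _ _ _ Bw Av))) _.
  exact: (br_anticomm df skewQ).
- move=> A B E /rp[v Av] /rp[w Bw] /rp[z Ez].
  have b3 := bracket3_represents.
  apply: prel_eq3 (prelD cm2 (prelD cm2 (b3 _ _ _ _ _ _ Av Bw Ez)
    (cyc_represents (b3 _ _ _ _ _ _ Bw Ez Av)))
    (cyc_represents (cyc_represents (b3 _ _ _ _ _ _ Ez Av Bw)))) (prel0 cm2) _.
  exact: (jacobiator_from_fields df skewQ jacobiQ).
Qed.
End Represented.
End PoissonTransfer.

(** * The complex numbers and the functions of tau *)

Section ChainRule.
Variables (I : finType) (C : numClosedFieldType) (O : jet_domain I C).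

(** The chain rule for a function of w: the total derivative is a combination
    of the partial ones. *)
Lemma regDtot_chain (h q w : regfun O) :
  (forall a, regpder a h = regpder a w * q) -> regDtot h = regDtot w * q.
Proof.
move=> hE; have [N hN] := regpder_fin w.
rewrite (regDtotE hN) (@regDtotE _ _ _ _ N) => [|a /hN]; last by rewrite hE => ->; rewrite mul0r.
rewrite mulr_suml; apply: eq_bigr => i _; rewrite mulr_suml; apply: eq_bigr => n _.
by rewrite hE mulrA.
Qed.
End ChainRule.

Section ComplexFields.
Variables (R : realType) (g1 g2 g3 : cplx R -> cplx R).
Local Notation C := (cplx R).
Local Notation jet := (jet field3 C).
Local Notation fct := (jet -> C).

Lemma complex_plane_cplx :
  @complex_plane R C (real_complex R : {rmorphism R -> C}) (@complex.Re R).
Proof.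
split.
- by move=> x; rewrite [LHS]normc_def /= expr0n addr0 sqrtr_sqr.
- exact: ltcR.
- move=> e e0; have /complex_realP[r re] : e \is Num.real by rewrite realE ltW.
  by exists r.
- by case=> ? ? [? ?].
- by move=> x [a b] /=; rewrite mul0r subr0.
- exact: normc_ge_Re.
- move=> [x y] [x' y'] E; have := E 1; have := E ('i)%C.
  by rewrite !mul1r /= !mul0r !sub0r !mul1r => /oppr_inj -> ->.
Qed.

Lemma cplx_pderC (D : set jet) F a b u : open D -> regular D F -> D u ->
  pder a (pder b F) u = pder b (pder a F) u.
Proof. exact: (pderC complex_plane_cplx). Qed.

Lemma twopii_neq0 : twopii R != 0.
Proof.
rewrite /twopii !mulf_neq0 ?pnatr_eq0 ?neq0Ci //.
by rewrite /piC -[0 : C]/(real_complex R 0) (inj_eq (@complexI R)) gt_eqF ?pi_gt0.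
Qed.

Lemma open_upper_half : open (@upper_half R).
Proof.
(* Im z = Re (- i z) *)
pose im (u : jet) : R := complex.Re (- ('i)%C * u (Tau, 0%N) : C).
have -> : @upper_half R = im @^-1` [set r | 0 < r].
  apply/funext => u; apply/propext; rewrite /upper_half /im /=.
  rewrite -complexIm (_ : complex.Re _ = complex.Im (u (Tau, 0%N))) ?(ltcR 0) //.
  by case: (u _) => a b /=; ring.
apply: open_comp; last exact: open_gt.
move=> u _.
have c1 : (fun w : C => - ('i)%C * w) @ (u (Tau, 0%N)) --> (- ('i)%C * u (Tau, 0%N) : C).
  exact: mulrl_continuous.
have c2 := cvg_comp _ _ (@coord_continuous field3 C (Tau, 0%N) u) c1.
exact: (cvg_comp _ _ c2 (reC_continuous complex_plane_cplx (x := _))).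
Qed.

(** The set where the ratio of the two fields is defined. *)
Definition chart : set jet := [set u | upper_half u /\ u (Z2, 0%N) != 0].

Lemma open_chart : open chart.
Proof.
have -> : chart = @upper_half R `&` (fun u : jet => u (Z2, 0%N)) @^-1` (~` [set (0 : C)]).
  apply/funext => u; apply/propext; split=> -[uh /eqP u0]; split => //.
apply: openI; first exact: open_upper_half.
apply: open_comp; first by move=> u _; exact: coord_continuous.
apply: closed_openC; apply: accessible_closed_set1; apply: hausdorff_accessible.
exact: norm_hausdorff.
Qed.

Definition chart_pt : jet := fun a => if a == (Tau, 0%N) then 'i else 1.

Lemma chart_ptP : chart chart_pt.
Proof.
split; rewrite /upper_half /chart_pt /= xpair_eqE eq_field3E /=; last exact: oner_neq0.
by rewrite Im_i ltr01.
Qed.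

Hypothesis hder : forall t : C, 0 < 'Im t ->
  [/\ derivable g1 t 1, derivable g2 t 1 & derivable g3 t 1].
Hypothesis hg1 : forall t : C, 0 < 'Im t ->
  twopii R * derive1 g1 t = 12^-1 * g2 t - g1 t ^+ 2.
Hypothesis hg2 : forall t : C, 0 < 'Im t ->
  twopii R * derive1 g2 t = 6 * g3 t - 4 * g1 t * g2 t.
Hypothesis hg3 : forall t : C, 0 < 'Im t ->
  twopii R * derive1 g3 t = 3^-1 * g2 t ^+ 2 - 6 * g1 t * g3 t.

Local Notation K := (twopii R).
Definition scaled_g1 (t : C) : C := g1 t.
Definition scaled_g2 (t : C) : C := 12^-1 * g2 t.
Definition scaled_g3 (t : C) : C := 2^-1 * g3 t.
Definition along (g : C -> C) : fct := fun u => g (u (Tau, 0%N)).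

(** In terms of h1, h2, h3 the differential equations have integer
    coefficients, up to the factor 1 / (2 pi i). *)
Lemma scaled_derive t : 0 < 'Im t ->
  [/\ derivable scaled_g1 t 1, derivable scaled_g2 t 1 & derivable scaled_g3 t 1] /\
  [/\ derive1 scaled_g1 t = K^-1 * (scaled_g2 t - scaled_g1 t * scaled_g1 t),
      derive1 scaled_g2 t = K^-1 * (scaled_g3 t - scaled_g1 t * scaled_g2 t *+ 4) &
      derive1 scaled_g3 t =
        K^-1 * (scaled_g2 t * scaled_g2 t *+ 24 - scaled_g1 t * scaled_g3 t *+ 6)].
Proof.
move=> t0; have [d1 d2 d3] := hder t0; have K0 := twopii_neq0.
have n12 : (12 : C) != 0 by rewrite pnatr_eq0.
have n2 : (2 : C) != 0 by rewrite pnatr_eq0.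
have n3 : (3 : C) != 0 by rewrite pnatr_eq0.
have D2 : derive1 scaled_g2 t = 12^-1 * derive1 g2 t := derive1Ml _ d2.
have D3 : derive1 scaled_g3 t = 2^-1 * derive1 g3 t := derive1Ml _ d3.
have E (a b : C) : K * a = b -> a = K^-1 * b by move=> <-; rewrite (mulKf K0).
split.
  split; first exact: d1.
    exact: (derivableM (derivable_cst _ _ _) d2).
  exact: (derivableM (derivable_cst _ _ _) d3).
rewrite D2 D3 /scaled_g1 /scaled_g2 /scaled_g3; split.
- by rewrite (E _ _ (hg1 t0)) expr2.
- by rewrite (E _ _ (hg2 t0)); field; rewrite ?n12 ?n2 ?K0.
- by rewrite (E _ _ (hg3 t0)); field; rewrite ?n12 ?n2 ?K0 ?n3.
Qed.

Definition eval_at (u : jet) (e : expr) : C :=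
  eval (fun a => u a : C) K K^-1 (scaled_g1 (u (Tau, 0%N)))
    (scaled_g2 (u (Tau, 0%N))) (scaled_g3 (u (Tau, 0%N))) e.

(** The terms in tau' of the bracket are written with i / pi. *)
Lemma twopiiV : K^-1 = - 'i / (2 * piC R) :> C.
Proof.
have K0 := twopii_neq0; apply: (mulfI K0); rewrite (mulfV K0).
have p0 : piC R != 0 by apply: contra_neq K0 => p0; rewrite /twopii p0 mulr0 mul0r.
have n2 : (2 : C) != 0 by rewrite pnatr_eq0.
have i2 : 'i * 'i = -1 :> C by rewrite -expr2 sqrCi.
have -> : K * (- 'i / (2 * piC R)) = - ('i * 'i) * ((2 * piC R) / (2 * piC R)).
  by rewrite /twopii; ring.
by rewrite i2 opprK mul1r mulfV // mulf_neq0.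
Qed.

Section OnDomain.
Variable O : jet_domain field3 C.
Hypothesis Oup : dom_set O `<=` @upper_half R.
Local Notation D := (dom_set O).
Local Notation W := (regfun O).
Let oD : open D := dom_open O.
Let cm := compatible_represents O.

Definition scaled_along : set fct :=
  fun F => [\/ F = along scaled_g1, F = along scaled_g2 | F = along scaled_g3].

(** The differential equations express the derivatives of g1, g2, g3 as
    polynomials in g1, g2, g3: one complex derivative gives all of them. *)
Lemma regular_along F : scaled_along F -> regular D F.
Proof.
move=> mF; split.
  by case: mF => ->; exact: finite_order_coord.
have alg g : scaled_along (along g) -> algebraic scaled_along (along g) by exact: alg_base.
have m1 : scaled_along (along scaled_g1) by constructor 1.
have m2 : scaled_along (along scaled_g2) by constructor 2.
have m3 : scaled_along (along scaled_g3) by constructor 3.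
apply: (@smooth_algebraic _ _ D scaled_along oD) (alg_base mF) => {F mF} F mF.
  move=> u Du; have [[d1 d2 d3] _] := scaled_derive (Oup Du).
  have [g [-> dg]] : exists g, F = along g /\ derivable g (u (Tau, 0%N)) 1.
    by case: mF => ->; [exists scaled_g1|exists scaled_g2|exists scaled_g3].
  split=> [|a]; last exact: (pder_comp a dg).1.
  have cg : {for u (Tau, 0%N), continuous g}.
    by apply: differentiable_continuous; apply/derivable1_diffP.
  exact: (cvg_comp _ _ (@coord_continuous field3 C (Tau, 0%N) u) cg).
move=> a; pose c := (a == (Tau, 0%N))%:R * K^-1 : C.
(* the right-hand sides of the differential equations *)
pose F1 : fct := cst c * (along scaled_g2 - along scaled_g1 * along scaled_g1).
pose F2 : fct := cst c * (along scaled_g3 - along scaled_g1 * along scaled_g2 * cst 4).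
pose F3 : fct := cst c *
  (along scaled_g2 * along scaled_g2 * cst 24 - along scaled_g1 * along scaled_g3 * cst 6).
have aF1 : algebraic scaled_along F1.
  do !(exact: (alg _ m1) || exact: (alg _ m2) || exact: (alg _ m3) ||
    apply: alg_cst || apply: alg_opp || apply: alg_add || apply: alg_mul).
have aF2 : algebraic scaled_along F2.
  do !(exact: (alg _ m1) || exact: (alg _ m2) || exact: (alg _ m3) ||
    apply: alg_cst || apply: alg_opp || apply: alg_add || apply: alg_mul).
have aF3 : algebraic scaled_along F3.
  do !(exact: (alg _ m1) || exact: (alg _ m2) || exact: (alg _ m3) ||
    apply: alg_cst || apply: alg_opp || apply: alg_add || apply: alg_mul).
case: mF => ->; [exists F1|exists F2|exists F3] => // u Du;
  have [[d1 d2 d3] [E1 E2 E3]] := scaled_derive (Oup Du).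
- by rewrite (pder_comp a d1).2 E1 mulrA.
- by rewrite (pder_comp a d2).2 E2 mulrA -[_ *+ 4]mulr_natr.
- by rewrite (pder_comp a d3).2 E3 mulrA -[_ *+ 24]mulr_natr -[_ *+ 6]mulr_natr.
Qed.

(** The elements of [regfun] that K, k, h1, h2, h3 stand for, with the
    relations on which the symbolic computation relies. *)
Record structure_elements (Kv kv h1 h2 h3 : W) : Prop := {
  co_K : represents (cst K) Kv; co_k : represents (cst K^-1) kv;
  co_1 : represents (along scaled_g1) h1; co_2 : represents (along scaled_g2) h2;
  co_3 : represents (along scaled_g3) h3;
  co_Kk : Kv * kv = 1;
  co_dK : regDtot Kv = 0; co_dk : regDtot kv = 0;
  co_pdK : forall a, regpder a Kv = 0; co_pdk : forall a, regpder a kv = 0;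
  co_dH : forall d : {additive W -> W},
    (d = @regDtot _ _ O :> {additive W -> W} \/
     exists a, d = @regpder _ _ O a :> {additive W -> W}) ->
  [/\ d h1 = d (regfld O (Tau, 0%N)) * (kv * (h2 - h1 * h1)),
      d h2 = d (regfld O (Tau, 0%N)) * (kv * (h3 - h1 * h2 *+ 4)) &
      d h3 = d (regfld O (Tau, 0%N)) * (kv * (h2 * h2 *+ 24 - h1 * h3 *+ 6))] }.

Lemma structure_elements_exist : exists Kv kv h1 h2 h3, structure_elements Kv kv h1 h2 h3.
Proof.
have [Kv [cK pK dK]] := represents_cst O K.
have [kv [ck pk dk]] := represents_cst O K^-1.
have [h1 c1] := representable (regular_along (Or31 _ _ (erefl (along scaled_g1)))).
have [h2 c2] := representable (regular_along (Or32 _ _ (erefl (along scaled_g2)))).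
have [h3 c3] := representable (regular_along (Or33 _ _ (erefl (along scaled_g3)))).
exists Kv, kv, h1, h2, h3.
have Kk : Kv * kv = 1.
  apply: represents_inj (representsM cK ck) (represents1 O) _ => u _.
  exact: (mulfV twopii_neq0).
have pderH a : [/\ regpder a h1 = regpder a (regfld O (Tau, 0%N)) * (kv * (h2 - h1 * h1)),
      regpder a h2 = regpder a (regfld O (Tau, 0%N)) * (kv * (h3 - h1 * h2 *+ 4)) &
      regpder a h3 = regpder a (regfld O (Tau, 0%N)) * (kv * (h2 * h2 *+ 24 - h1 * h3 *+ 6))].
  have pt := represents_pder a (represents_fld O Tau 0).
  split.
  - apply: represents_inj (represents_pder a c1)
      (representsM pt (representsM ck (representsD c2 (representsN (representsM c1 c1))))) _.
    move=> u Du; have [[d1 d2 d3] [E1 E2 E3]] := scaled_derive (Oup Du).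
    by rewrite (pder_comp a d1).2 E1 -(pder_fld a Tau 0 u).2.
  - apply: represents_inj (represents_pder a c2)
      (representsM pt (representsM ck (representsD c3
         (representsN (cm_Mn cm 4 (representsM c1 c2)))))) _.
    move=> u Du; have [[d1 d2 d3] [E1 E2 E3]] := scaled_derive (Oup Du).
    by rewrite (pder_comp a d2).2 E2 -(pder_fld a Tau 0 u).2.
  - apply: represents_inj (represents_pder a c3)
      (representsM pt (representsM ck (representsD (cm_Mn cm 24 (representsM c2 c2))
         (representsN (cm_Mn cm 6 (representsM c1 c3)))))) _.
    move=> u Du; have [[d1 d2 d3] [E1 E2 E3]] := scaled_derive (Oup Du).
    by rewrite (pder_comp a d3).2 E3 -(pder_fld a Tau 0 u).2.
have dH : forall d : {additive W -> W},
    (d = @regDtot _ _ O :> {additive W -> W} \/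
     exists a, d = @regpder _ _ O a :> {additive W -> W}) ->
  [/\ d h1 = d (regfld O (Tau, 0%N)) * (kv * (h2 - h1 * h1)),
      d h2 = d (regfld O (Tau, 0%N)) * (kv * (h3 - h1 * h2 *+ 4)) &
      d h3 = d (regfld O (Tau, 0%N)) * (kv * (h2 * h2 *+ 24 - h1 * h3 *+ 6))].
  move=> d [->|[a ->]]; last exact: pderH.
  by split; apply: regDtot_chain => a; have [] := pderH a.
exact: (Build_structure_elements cK ck c1 c2 c3 Kk dK dk pK pk dH).
Qed.
End OnDomain.
End ComplexFields.

(** * The given bracket over the upper half plane *)

Section OnGivenDomain.
Variables (R : realType) (g1 g2 g3 : cplx R -> cplx R).
Local Notation C := (cplx R).
Local Notation jet := (jet field3 C).
Local Notation fct := (jet -> C).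
Local Notation K := (twopii R).
Variable O : jet_domain field3 C.
Local Notation D := (dom_set O).
Local Notation W := (regfun O).
Let cm := compatible_represents O.
Variables (Kv kv h1 h2 h3 : W).
Hypothesis co : structure_elements g1 g2 g3 Kv kv h1 h2 h3.

Definition eval_regfun := eval (regfld O) Kv kv h1 h2 h3.

Lemma natmul_fct (F : fct) n : F *+ n = (fun u => F u *+ n).
Proof.
apply/funext => u; elim: n => [|n IHn]; first by rewrite !mulr0n.
by rewrite !mulrS -IHn.
Qed.

Lemma represents_eval e : represents (fun u => eval_at g1 g2 g3 u e) (eval_regfun e).
Proof.
rewrite /eval_at /eval_regfun; elim: e => [||||| s n |||e IHe f IHf|e IHe|e IHe f IHf|e IHe n] /=.
- exact: (co_K co).
- exact: (co_k co).
- exact: (co_1 co).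
- exact: (co_2 co).
- exact: (co_3 co).
- exact: (represents_fld O s n).
- exact: (represents0 O).
- exact: (represents1 O).
- exact: (representsD IHe IHf).
- exact: (representsN IHe).
- exact: (representsM IHe IHf).
- rewrite -natmul_fct; exact: (cm_Mn cm n IHe).
Qed.

Lemma prel_hydro (G H : fct) e f :
  (forall u, G u = eval_at g1 g2 g3 u e) -> (forall u, H u = eval_at g1 g2 g3 u f) ->
  prel (@represents _ _ O) (G *: delta 1 + H *: delta 0)
    ((eval_regfun f)%:P + eval_regfun e *: 'X).
Proof.
move=> /funext-> /funext->; rewrite addrC; apply: (prelD cm).
  rewrite -alg_polyC -(expr0 'X).
  exact: (prelZXn cm 0 (represents_eval f)).
rewrite -['X]expr1; exact: (prelZXn cm 1 (represents_eval e)).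
Qed.

Local Notation DtotA := (@regDtot _ _ O : {additive W -> W}).
Local Notation pderA := (fun a => @regpder _ _ O a : {additive W -> W}).

Definition generator_bracket :=
  hydro (fun i j => eval_regfun (sym_g i j)) (fun i j => eval_regfun (sym_h i j)).

Lemma dfO : differential_functions DtotA pderA (regfld O).
Proof.
apply: differential_regfun => F a b u; exact: (cplx_pderC a b (dom_open O)).
Qed.

Let DtotK : DtotA Kv = 0 := co_dK co.
Let Dtotk : DtotA kv = 0 := co_dk co.
Let pderK : forall a, pderA a Kv = 0 := co_pdK co.
Let pderk : forall a, pderA a kv = 0 := co_pdk co.

Lemma generator_bracket_skew i j : generator_bracket i j = - flip DtotA (generator_bracket j i).
Proof.
have dH := co_dH co.
have skew := @gen_skew _ DtotA pderA (regfld O) dfO Kv kv h1 h2 h3 DtotK Dtotk dH.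
exact (skew i j).
Qed.

Lemma generator_bracket_jacobi i j k :
  jacobiator DtotA pderA generator_bracket
    (regfld O (i, 0%N)) (regfld O (j, 0%N)) (regfld O (k, 0%N)) = 0.
Proof.
have dH := co_dH co.
have Kk := co_Kk co.
have jacobi := @gen_jacobi _ DtotA pderA (regfld O) dfO Kv kv h1 h2 h3
  Kk DtotK Dtotk pderK pderk dH.
exact (jacobi i j k).
Qed.

Lemma generator_bracket_TauE a : a != Tau ->
  generator_bracket Tau a = aty DtotA (Kv * regfld O (a, 0%N)) 'X.
Proof.
have TauE := @gen_TauE _ DtotA pderA (regfld O) dfO Kv kv h1 h2 h3 DtotK a.
exact TauE.
Qed.

(** The displayed formulas, after dividing g2 by 12 and g3 by 2 and writing
    i / pi through 1 / (2 pi i), are the symbolic ones. *)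
Lemma prel_generator_bracket i j :
  prel (@represents _ _ O) (basic_bracket g1 g2 g3 i j) (generator_bracket i j).
Proof.
have tz a : a != Tau -> prel (@represents _ _ O) (tau_z R a) (generator_bracket Tau a).
  move=> aT; rewrite generator_bracket_TauE //; apply: (prel_aty cm).
    exact: (representsM (co_K co) (represents_fld O a 0)).
  rewrite /delta expr1 => k; rewrite !coefX; case: eqP => _.
    exact: represents1.
  exact: represents0.
have n2 : (2 : C) != 0 by rewrite pnatr_eq0.
have n3 : (3 : C) != 0 by rewrite pnatr_eq0.
have n4 : (4 : C) != 0 by rewrite pnatr_eq0.
have n6 : (6 : C) != 0 by rewrite pnatr_eq0.
have n12 : (12 : C) != 0 by rewrite pnatr_eq0.
have n24 : (24 : C) != 0 by rewrite pnatr_eq0.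
have p0 : piC R != 0.
  by apply: contra_neq (@twopii_neq0 R) => p0; rewrite /twopii p0 mulr0 mul0r.
have h12 : prel (@represents _ _ O) (z1_z2 g1 g2 g3) (generator_bracket Z1 Z2).
  apply: prel_hydro => u; rewrite /eval_at /= /scaled_g1 /scaled_g2 /scaled_g3 ?twopiiV;
    move: (piC R) p0 => pc p0; field; by rewrite ?n2 ?n3 ?n4 ?n6 ?n12 ?n24 ?p0.
have n1T : Z1 != Tau by rewrite eq_field3E.
have n2T : Z2 != Tau by rewrite eq_field3E.
case: i j => -[].
- have T := @gen_Tau0 _ (regfld O) Kv kv h1 h2 h3.
  have -> : generator_bracket Tau Tau = 0 by exact T.
  exact: (prel0 cm).
- exact: (tz Z1 n1T).
- exact: (tz Z2 n2T).
- by rewrite generator_bracket_skew; apply: (prelN cm); apply: (prel_flip cm); exact: (tz Z1 n1T).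
- apply: prel_hydro => u; rewrite /eval_at /= /scaled_g1 /scaled_g2 /scaled_g3 ?twopiiV;
    move: (piC R) p0 => pc p0; field; by rewrite ?n2 ?n3 ?n4 ?n6 ?n12 ?n24 ?p0.
- exact: h12.
- by rewrite generator_bracket_skew; apply: (prelN cm); apply: (prel_flip cm); exact: (tz Z2 n2T).
- by rewrite generator_bracket_skew; apply: (prelN cm); apply: (prel_flip cm).
- apply: prel_hydro => u; rewrite /eval_at /= /scaled_g1 /scaled_g2 /scaled_g3 ?twopiiV;
    move: (piC R) p0 => pc p0; field; by rewrite ?n2 ?n3 ?n4 ?n6 ?n12 ?n24 ?p0.
Qed.

Lemma poisson_on : poisson_structure D (basic_bracket g1 g2 g3).
Proof.
apply: (poisson_transfer _ prel_generator_bracket generator_bracket_skew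
  generator_bracket_jacobi) => F a b u.
exact: (cplx_pderC a b (dom_open O)).
Qed.
End OnGivenDomain.

(** * The Poisson structure and the bracket of the ratio *)

Section Conclusion.
Local Opaque dx flip aty dy.
Variables (R : realType) (g1 g2 g3 : cplx R -> cplx R).
Local Notation C := (cplx R).
Local Notation jet := (jet field3 C).
Local Notation fct := (jet -> C).
Hypothesis hder : forall t : C, 0 < 'Im t ->
  [/\ derivable g1 t 1, derivable g2 t 1 & derivable g3 t 1].
Hypothesis hg1 : forall t : C, 0 < 'Im t ->
  twopii R * derive1 g1 t = 12^-1 * g2 t - g1 t ^+ 2.
Hypothesis hg2 : forall t : C, 0 < 'Im t ->
  twopii R * derive1 g2 t = 6 * g3 t - 4 * g1 t * g2 t.
Hypothesis hg3 : forall t : C, 0 < 'Im t ->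
  twopii R * derive1 g3 t = 3^-1 * g2 t ^+ 2 - 6 * g1 t * g3 t.
Local Notation P := (basic_bracket g1 g2 g3).

Definition chart_dom : jet_domain field3 C := JetDomain (@open_chart R) (@chart_ptP R).
Local Notation W := (regfun chart_dom).
Local Notation DtotA := (@regDtot _ _ chart_dom : {additive W -> W}).
Local Notation pderA := (fun a => @regpder _ _ chart_dom a : {additive W -> W}).

Lemma chart_upper : dom_set chart_dom `<=` @upper_half R.
Proof. by move=> u []. Qed.

(** Finite order does not refer to a domain, so one domain is enough to
    obtain it. *)
Lemma basic_finite_order i j k : finite_order (P i j)`_k.
Proof.
have [Kv [kv [h1 [h2 [h3 co]]]]] := structure_elements_exist hder hg1 hg2 hg3 chart_upper.
by have [[fo _] _] := prel_generator_bracket co i j k.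
Qed.

(** On the empty set every identity is void, and only the regularity of the
    brackets, that is their finite order, has a content. *)
Lemma poisson_open (D : set jet) : open D -> D `<=` @upper_half R -> poisson_structure D P.
Proof.
move=> oD Dup; have [->|/set0P[u Du]] := eqVneq D set0.
  split; try (repeat intro; match goal with H : set0 _ |- _ => case: H end).
  move=> A B [foA _] [foB _] k; apply/set0_regular.
  exact: (finite_order_bracket basic_finite_order foA foB k).
have [Kv [kv [h1 [h2 [h3 co]]]]] :=
  @structure_elements_exist _ _ _ _ hder hg1 hg2 hg3 (JetDomain oD Du) Dup.
exact: (poisson_on co).
Qed.

Local Notation z1 := (regfld chart_dom (Z1, 0%N)).
Local Notation z2 := (regfld chart_dom (Z2, 0%N)).

Lemma ratio_represented : exists2 zi, z2 * zi = 1 & represents (@pfun R) (z1 * zi).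
Proof.
have r2 := @regular_fld field3 C _ (dom_open chart_dom) Z2 0.
have n2 u : dom_set chart_dom u -> fld Z2 0 u != 0 :> C by case.
have [zi ri] := @representable _ _ chart_dom _ (regularV (dom_open chart_dom) r2 n2).
exists zi.
  apply: represents_inj (representsM (represents_fld chart_dom Z2 0) ri)
    (represents1 chart_dom) _ => u Du.
  exact: (mulfV (n2 u Du)).
exact: (representsM (represents_fld chart_dom Z1 0) ri).
Qed.

Lemma val_regfunM (v w : W) u : val (v * w) u = val v u * val w u.
Proof. by []. Qed.
Lemma val_regfunD (v w : W) u : val (v + w) u = val v u + val w u.
Proof. by []. Qed.

Lemma tau_central :
  eq2 [set u | upper_half u /\ u (Z2, 0%N) != 0] (bracket P (fld Tau 0) (@pfun R)) 0.
Proof.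
have [Kv [kv [h1 [h2 [h3 co]]]]] := structure_elements_exist hder hg1 hg2 hg3 chart_upper.
have [zi zK rp] := ratio_represented.
have dK : DtotA Kv = 0 := co_dK co.
have tau0 := @br_tau_ratio _ DtotA pderA _ (dfO chart_dom) Kv kv h1 h2 h3 dK zi zK.
have cm := compatible_represents chart_dom.
have sch := fun F a b u => @cplx_pderC R _ F a b u (dom_open chart_dom).
have prb := bracket_represents sch (prel_generator_bracket co) (represents_fld chart_dom Tau 0) rp.
exact: (prel_eq2 prb (prel0 cm) tau0).
Qed.

(** On jets with tau' = 0 the terms of [d_ratio_metric] proportional to tau'
    vanish, and half of what remains of the derivative of the metric is
    G'(p) p' / 2. *)
Lemma pp_bracket (t : C) : 0 < 'Im t ->
  eq2 [set u | [/\ u (Tau, 0%N) = t, (forall n, u (Tau, n.+1) = 0) & u (Z2, 0%N) != 0]]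
    (bracket P (@pfun R) (@pfun R))
    ((fun u => (Gpoly g2 g3 t).[pfun u]) *: delta 1
     + (fun u => 2^-1 * (deriv (Gpoly g2 g3 t)).[pfun u] * Dtot (@pfun R) u) *: delta 0).
Proof.
move=> t0 k u [ut ut' uz].
have Du : dom_set chart_dom u by split; rewrite // /upper_half /= ut.
have [Kv [kv [h1 [h2 [h3 co]]]]] := structure_elements_exist hder hg1 hg2 hg3 chart_upper.
have [zi zK rp] := ratio_represented.
have dK : DtotA Kv = 0 := co_dK co.
have dk : DtotA kv = 0 := co_dk co.
have dH := co_dH co.
have [c E cc] := @br_ratio _ DtotA pderA _ (dfO chart_dom) Kv kv h1 h2 h3 dK dk dH zi zK.
have [q Eq] := @d_ratio_metric _ DtotA pderA _ (dfO chart_dom) kv h1 h2 h3 dH zi.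
have sch := fun F a b u => @cplx_pderC R _ F a b u (dom_open chart_dom).
have prb := bracket_represents sch (prel_generator_bracket co) rp rp.
have [_ /(_ u Du) Ek] := prb k; rewrite Ek {Ek prb}.
have -> : br DtotA pderA (generator_bracket Kv kv h1 h2 h3) (z1 * zi) (z1 * zi) =
    c%:P + ratio_metric (regfld chart_dom) h2 h3 zi *: 'X by exact E.
have pu : pfun u = val (z1 * zi) u by case: rp => _; apply.
have dpu : Dtot (@pfun R) u = val (regDtot (z1 * zi)) u.
  by have [_ H] := represents_Dtot rp; exact: H.
have h2u : val h2 u = 12^-1 * g2 t by rewrite -ut; have [_ <-] := co_2 co.
have h3u : val h3 u = 2^-1 * g3 t by rewrite -ut; have [_ <-] := co_3 co.
have tu : val (regfld chart_dom (Tau, 1%N)) u = 0.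
  by have [_ <-] := represents_fld chart_dom Tau 1; rewrite // /fld ut'.
have valMn (w : W) n : val (w *+ n) u = val w u *+ n.
  by elim: n => [|n IHn]; rewrite ?mulr0n // !mulrS val_regfunD IHn.
have valN (w : W) : val (- w) u = - val w u by [].
have Gu : val (ratio_metric (regfld chart_dom) h2 h3 zi) u = (Gpoly g2 g3 t).[pfun u].
  rewrite /ratio_metric; move: (z1 * zi) (pfun u) pu => p y pu.
  rewrite !(valMn, val_regfunD, valN, val_regfunM) -pu h2u h3u /Gpoly.
  by rewrite !(hornerE, hornerXn) /=; field.
(* twice both sides, as it is c + c that is known *)
have cu : val c u = 2^-1 * (Gpoly g2 g3 t)^`().[pfun u] * Dtot (@pfun R) u.
  have n2 : (2 : C) != 0 by rewrite pnatr_eq0.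
  apply: (mulfI n2); rewrite mulrA mulVKf // (_ : 2 * val c u = val (c + c) u); last first.
    by rewrite val_regfunD mulr_natl mulr2n.
  rewrite cc Eq; move: (z1 * zi) (pfun u) (Dtot _ u) pu dpu => w y y' pu dpu.
  rewrite !(valMn, val_regfunD, valN, val_regfunM) tu mul0r add0r -pu -dpu h2u /Gpoly.
  by rewrite !poly.derivE !(hornerE, hornerXn) /=; field.
have -> : (c%:P + ratio_metric (regfld chart_dom) h2 h3 zi *: 'X)`_k =
    (if k is 0 then c else 0) + (if k is 1 then ratio_metric (regfld chart_dom) h2 h3 zi else 0).
  by rewrite coefD coefC coefZ coefX; case: k => [|[|k]]; rewrite /= ?mulr0 ?mulr1.
rewrite /delta expr0 expr1 coefD !coefZ coefX coef1.
case: k => [|[|k]]; rewrite /= ?mulr0 ?mulr1 ?addr0 ?add0r.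
- exact: cu.
- exact: Gu.
- by [].
Qed.
End Conclusion.

Theorem proposition2 (R : realType) (g1 g2 g3 : cplx R -> cplx R)
  (hder : forall t : cplx R, 0 < 'Im t ->
     [/\ derivable g1 t 1, derivable g2 t 1 & derivable g3 t 1])
  (hg1 : forall t : cplx R, 0 < 'Im t ->
     twopii R * derive1 g1 t = 12^-1 * g2 t - g1 t ^+ 2)
  (hg2 : forall t : cplx R, 0 < 'Im t ->
     twopii R * derive1 g2 t = 6 * g3 t - 4 * g1 t * g2 t)
  (hg3 : forall t : cplx R, 0 < 'Im t ->
     twopii R * derive1 g3 t = 3^-1 * g2 t ^+ 2 - 6 * g1 t * g3 t) :
  let P := basic_bracket g1 g2 g3 in
  let p := @pfun R in
  [/\ (forall D : set (jet field3 (cplx R)), open D -> D `<=` @upper_half R ->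
         poisson_structure D P),
      eq2 [set u | upper_half u /\ u (Z2, 0%N) != 0]
          (bracket P (fld Tau 0) p) 0
    & forall t : cplx R, 0 < 'Im t ->
        eq2 [set u | [/\ u (Tau, 0%N) = t, (forall n, u (Tau, n.+1) = 0)
                       & u (Z2, 0%N) != 0]]
            (bracket P p p)
            ((fun u => (Gpoly g2 g3 t).[p u]) *: delta 1
             + (fun u => 2^-1 * (deriv (Gpoly g2 g3 t)).[p u] * Dtot p u)
                 *: delta 0)].
Proof.
split.
- by move=> D oD Dup; apply: (poisson_open hder hg1 hg2 hg3 oD Dup).
- exact: (tau_central hder hg1 hg2 hg3).
- exact: (pp_bracket hder hg1 hg2 hg3).
Qed.
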